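(* Let $H$ be a locally compact Abelian group and let $\Gamma$ be its dual group. Then the Fourier transform $\mathcal{F}: L_1(H)\to C_0(\Gamma)$ is a lush operator. In particular, $\mathcal{F}$ is a spear operator, that is, $$\sup_{\omega\in\mathbb{T}}\|\mathcal{F}+\omega T\| = 1+\|T\|$$ for every bounded linear operator $T: L_1(H)\to C_0(\Gamma)$.
   Context: Scalars are complex; $\mathbb{T}=\{\omega\in\mathbb{C}:|\omega|=1\}$. $\sigma$ is the Haar measure on $H$, $L_1(H)$ is the space of (complex) $\sigma$-integrable functions on $H$, $\Gamma$ is the set of continuous homomorphisms $\gamma:H\to\mathbb{T}$ with its usual locally compact group topology, and $C_0(\Gamma)$ is the space of complex continuous functions on $\Gamma$ vanishing at infinity, with the sup norm. The Fourier transform is $[\mathcal{F}(f)](\gamma)=\int_H f(x)\gamma(x^{-1})\,d\sigma(x)$. For a Banach space $X$ over $\mathbb{K}$ ($\mathbb{R}$ or $\mathbb{C}$), $B_X$ and $S_X$ are the closed unit ball and unit sphere; $\operatorname{aconv}(F)=\operatorname{conv}(\mathbb{T}F)$ is the absolutely convex hull. Lush operator: a norm-one operator $G\in L(X,Y)$ is lush if for every $x_0\in B_X$, every $\varepsilon>0$ and every $y\in S_Y$ there is a set $F\subset B_X$ such that $\operatorname{conv}(F)\subset\{x\in B_X:\|Gx+y\|>2-\varepsilon\}$ and $\operatorname{dist}(x_0,\operatorname{aconv}(F))<\varepsilon$. *)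

(* Defs.v *)
From HB Require Import structures.
From mathcomp Require Import all_boot all_order all_algebra complex.
From mathcomp Require Import all_classical all_reals all_analysis.
From mathcomp Require Import measurable_realfun.

Set Implicit Arguments.
Unset Strict Implicit.
Unset Printing Implicit Defensive.

Import Order.TTheory GRing.Theory Num.Theory.
Import numFieldNormedType.Exports.
Import Quotient.Exports.

Local Notation Re := (@complex.Re _).
Local Notation Im := (@complex.Im _).

Local Open Scope classical_set_scope.
Local Open Scope complex_scope.
Local Open Scope ring_scope.

HB.instance Definition _ (R : realType) := NormedModule.copy R[i] R[i]^o.

Definition unit_circle (R : realType) : set R[i] := [set w | `|w| = 1].
Definition unit_ball (R : realType) (X : normedModType R[i]) : set X :=
  [set x | `|x| <= 1].
Definition unit_sphere (R : realType) (X : normedModType R[i]) : set X :=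
  [set x | `|x| = 1].
Arguments unit_circle {R}.
Arguments unit_ball {R} X.
Arguments unit_sphere {R} X.

(* In a normed module over R[i] the norm `|x| is an element of R[i] (with zero
   imaginary part); rnorm x is the same number seen in R. *)
Definition rnorm (R : realType) (X : normedModType R[i]) (x : X) : R :=
  Re `|x|.

Section rnorm_theory.
Context {R : realType}.
Implicit Types X : normedModType R[i].

Lemma rnormE X (x : X) : (rnorm x)%:C = `|x|.
Proof. by rewrite /rnorm RRe_real// ger0_real. Qed.

Lemma rnorm_ge0 X (x : X) : 0 <= rnorm x.
Proof. by rewrite -ler0c rnormE. Qed.

Lemma rnormD X (x y : X) : rnorm (x + y) <= rnorm x + rnorm y.
Proof. by rewrite -lecR rmorphD/= !rnormE ler_normD. Qed.

Lemma rnormM (x y : R[i]) : rnorm (x * y) = rnorm x * rnorm y.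
Proof. by apply: complexI; rewrite rmorphM/= !rnormE normrM. Qed.

Lemma rnorm0_eq0 X (x : X) : rnorm x = 0 -> x = 0.
Proof. by move=> x0; apply/normr0_eq0; rewrite -rnormE x0. Qed.

Lemma rnorm0 X : rnorm (0 : X) = 0.
Proof. by rewrite /rnorm normr0. Qed.

Lemma rnorm1 : rnorm (1 : R[i]) = 1.
Proof. by apply: complexI; rewrite rnormE normr1. Qed.

Lemma rnormEc (z : R[i]) : rnorm z = Num.sqrt (Re z ^+ 2 + Im z ^+ 2).
Proof. by apply: complexI; rewrite rnormE normc_def. Qed.

Lemma normr_Re_le (z : R[i]) : `|Re z| <= rnorm z.
Proof. by rewrite rnormEc -sqrtr_sqr ler_wsqrtr// lerDl sqr_ge0. Qed.

Lemma normr_Im_le (z : R[i]) : `|Im z| <= rnorm z.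
Proof. by rewrite rnormEc -sqrtr_sqr ler_wsqrtr// lerDr sqr_ge0. Qed.

Lemma rnorm_le_ReIm (z : R[i]) : rnorm z <= `|Re z| + `|Im z|.
Proof.
rewrite rnormEc -[leRHS]ger0_norm ?addr_ge0// -sqrtr_sqr ler_wsqrtr//.
by rewrite sqrrD !real_normK ?num_real// lerD2r lerDl mulrn_wge0// mulr_ge0.
Qed.

Lemma complex_ReD (z w : R[i]) : Re (z + w) = Re z + Re w.
Proof. by case: z w => [a b] [c d]. Qed.

Lemma complex_ImD (z w : R[i]) : Im (z + w) = Im z + Im w.
Proof. by case: z w => [a b] [c d]. Qed.

Lemma complex_ReM (z w : R[i]) : Re (z * w) = Re z * Re w - Im z * Im w.
Proof. by case: z w => [a b] [c d]. Qed.

Lemma complex_ImM (z w : R[i]) : Im (z * w) = Re z * Im w + Im z * Re w.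
Proof. by case: z w => [a b] [c d]. Qed.

End rnorm_theory.

Section complex_L1.
Context d (T : measurableType d) (R : realType).
Variable mu : {measure set T -> \bar R}.

Definition cintegrable (f : T -> R[i]) : Prop :=
  mu.-integrable setT (EFin \o (Re \o f)) /\
  mu.-integrable setT (EFin \o (Im \o f)).

Definition cintegral (f : T -> R[i]) : R[i] :=
  (\int[mu]_x Re (f x))%R +i* (\int[mu]_x Im (f x))%R.

Definition cintegrable_pred : {pred (T -> R[i])} :=
  [pred f | `[< cintegrable f >]].

Lemma cintegrable_submod_closed : submod_closed cintegrable_pred.
Proof.
split=> [|a f g].
  by apply/asboolP; split; apply: (eq_integrable _ (cst 0%E)) => //;
    exact: integrable0.
move=> /asboolP[fr fi] /asboolP[gr gi]; apply/asboolP; split.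
- apply: (eq_integrable _ (fun x => ((Re a)%:E * (EFin \o (Re \o f)) x
     - (Im a)%:E * (EFin \o (Im \o f)) x) + (EFin \o (Re \o g)) x)%E) => //.
    by move=> x _; rewrite /= complex_ReD complex_ReM !EFinD EFinN !EFinM.
  by apply: integrableD => //; apply: integrableB => //; exact: integrableZl.
- apply: (eq_integrable _ (fun x => ((Re a)%:E * (EFin \o (Im \o f)) x
     + (Im a)%:E * (EFin \o (Re \o f)) x) + (EFin \o (Im \o g)) x)%E) => //.
    by move=> x _; rewrite /= complex_ImD complex_ImM !EFinD !EFinM.
  by apply: integrableD => //; apply: integrableD => //; exact: integrableZl.
Qed.

HB.instance Definition _ :=
  GRing.isSubmodClosed.Build _ _ cintegrable_pred cintegrable_submod_closed.

Definition L1fun : Type := {f : T -> R[i] | f \in cintegrable_pred}.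
HB.instance Definition _ := SubChoice.on L1fun.
HB.instance Definition _ := [SubChoice_isSubLmodule of L1fun by <:].
Definition L1fun_fun (f : L1fun) : T -> R[i] := val f.
Coercion L1fun_fun : L1fun >-> Funclass.

Definition ae_null : {pred L1fun} :=
  [pred f : L1fun | `[< {ae mu, forall x, f x = 0} >]].

Lemma ae_null_submod_closed : submod_closed ae_null.
Proof.
split=> [|a f g]; first by apply/asboolP; exact: aeW.
move=> /asboolP f0 /asboolP g0; apply/asboolP.
apply: filterS2 f0 g0 => x f0 g0.
rewrite -[LHS]/(a * (f : L1fun) x + (g : L1fun) x).
by rewrite f0 g0 mulr0 addr0.
Qed.

HB.instance Definition _ :=
  GRing.isSubmodClosed.Build _ _ ae_null ae_null_submod_closed.

(* The space of complex integrable functions modulo almost everywhere equality,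
   with norm f |-> \int |f|. *)
Definition L1 : Type := Quotient.quot ae_null.
HB.instance Definition _ := GRing.Zmodule.on L1.
HB.instance Definition _ := EqQuotient.on L1.

Definition L1_pi (f : L1fun) : L1 := (\pi_L1 f)%qT.
HB.instance Definition _ :=
  GRing.isZmodMorphism.Build L1fun L1 L1_pi (@pi_is_zmod_morphism _ _ _ L1).

Definition L1_repr (x : L1) : L1fun := repr x.

Lemma L1_piK (x : L1) : L1_pi (L1_repr x) = x.
Proof. exact: reprK. Qed.

Lemma L1_piP (f g : L1fun) :
  L1_pi f = L1_pi g <-> {ae mu, forall x, f x = g x}.
Proof.
suff -> : L1_pi f = L1_pi g <-> f - g \in ae_null.
  split=> [/asboolP|] H; last apply/asboolP; apply: filterS H => x.
    by move=> /eqP; rewrite -[eqbLHS]/(f x - g x) subr_eq0 => /eqP.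
  by rewrite -[_ = 0]/(f x - g x = 0) => ->; rewrite subrr.
by rewrite Quotient.idealrBE; split=> /eqP.
Qed.

Definition L1_scale (a : R[i]) (x : L1) : L1 := L1_pi (a *: L1_repr x).

Lemma L1_scale_pi a f : L1_scale a (L1_pi f) = L1_pi (a *: f).
Proof.
apply/L1_piP; have /L1_piP := L1_piK (L1_pi f); apply: filterS => x e.
exact: (congr1 ( *%R a) e).
Qed.

Lemma L1_scaleA a b x : L1_scale a (L1_scale b x) = L1_scale (a * b) x.
Proof. by rewrite -[x]L1_piK !L1_scale_pi scalerA. Qed.

Lemma L1_scale1 : left_id 1 L1_scale.
Proof. by move=> x; rewrite -[x]L1_piK L1_scale_pi scale1r. Qed.

Lemma L1_scaleDr : right_distributive L1_scale +%R.
Proof.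
move=> a x y; rewrite -[x]L1_piK -[y]L1_piK.
by rewrite -(raddfD L1_pi) !L1_scale_pi scalerDr (raddfD L1_pi).
Qed.

Lemma L1_scaleDl x : {morph L1_scale^~ x : a b / a + b}.
Proof.
by move=> a b; rewrite -[x]L1_piK !L1_scale_pi scalerDl (raddfD L1_pi).
Qed.

HB.instance Definition _ := GRing.Zmodule_isLmodule.Build R[i] L1
  L1_scaleA L1_scale1 L1_scaleDr L1_scaleDl.
HB.instance Definition _ := GRing.isScalable.Build R[i] L1fun L1 _ L1_pi
  (fun a f => esym (L1_scale_pi a f)).

Lemma integrable_rnorm (f : L1fun) :
  mu.-integrable setT (EFin \o (fun x => rnorm (f x))).
Proof.
have /asboolP[fr fi] := valP f.
have mr : measurable_fun setT (Re \o f).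
  by apply/measurable_EFinP; exact: measurable_int fr.
have mi : measurable_fun setT (Im \o f).
  by apply/measurable_EFinP; exact: measurable_int fi.
apply: (le_integrable _ _ _ (integrableD _ (integrable_abse fr)
  (integrable_abse fi))) => //.
- apply/measurable_EFinP.
  have ms : measurable_fun setT (@Num.sqrt R).
    by apply: continuous_measurable_fun; exact: (@sqrt_continuous R).
  have mf : measurable_fun setT (fun x => Re (f x) ^+ 2 + Im (f x) ^+ 2).
    by apply: measurable_funD; exact: measurable_funX.
  apply: (eq_measurable_fun (Num.sqrt \o
      (fun x => Re (f x) ^+ 2 + Im (f x) ^+ 2))) => [x _|].
    by rewrite /= rnormEc.
  exact: measurableT_comp ms mf.
- move=> x _; rewrite /= lee_fin ger0_norm ?rnorm_ge0//.
  by rewrite ger0_norm ?addr_ge0// rnorm_le_ReIm.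
Qed.

Lemma measurable_rnorm (f : L1fun) :
  measurable_fun setT (fun x => rnorm (f x)).
Proof. by apply/measurable_EFinP/(measurable_int mu)/integrable_rnorm. Qed.

Definition L1_norm (x : L1) : R[i] := (\int[mu]_t rnorm (L1_repr x t))%R%:C.

Lemma L1_norm_pi (f : L1fun) :
  L1_norm (L1_pi f) = (\int[mu]_t rnorm (f t))%R%:C.
Proof.
congr (_ %:C); congr fine; apply: ae_eq_integral => //.
- exact/measurable_EFinP/measurable_rnorm.
- exact/measurable_EFinP/measurable_rnorm.
- by have /L1_piP := L1_piK (L1_pi f); apply: filterS => x /= -> _.
Qed.

Lemma L1_normD x y : L1_norm (x + y) <= L1_norm x + L1_norm y.
Proof.
rewrite -[x]L1_piK -[y]L1_piK -(raddfD L1_pi) !L1_norm_pi -rmorphD/= lecR.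
rewrite -RintegralD//; [|exact: integrable_rnorm..].
apply: le_Rintegral => //; first exact: integrable_rnorm.
  have := integrableD measurableT (integrable_rnorm (L1_repr x))
    (integrable_rnorm (L1_repr y)).
  exact: eq_integrable.
by move=> t _; exact: rnormD.
Qed.

Lemma L1_normZ a x : L1_norm (a *: x) = `|a| * L1_norm x.
Proof.
rewrite -[x]L1_piK -[_ *: _]/(L1_scale _ _) L1_scale_pi !L1_norm_pi -(rnormE a) -rmorphM/=.
rewrite -RintegralZl//; last exact: integrable_rnorm.
congr (_ %:C); apply: eq_Rintegral => t _.
by rewrite -rnormM.
Qed.

Lemma L1_norm0_eq0 x : L1_norm x = 0 -> x = 0.
Proof.
rewrite -[x]L1_piK L1_norm_pi => /complexI H.
rewrite -(raddf0 L1_pi); apply/L1_piP.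
have If := integrable_rnorm (L1_repr x).
have : (\int[mu]_t `|(rnorm (L1_repr x t))%:E| = 0)%E.
  under eq_integral do rewrite abse_EFin ger0_norm ?rnorm_ge0//.
  by rewrite -(fineK (integrable_fin_num _ If))// -[fine _]/(Rintegral _ _ _) H.
have /measurable_EFinP mf := measurable_rnorm (L1_repr x).
move=> /(ae_eq_integral_abs mu measurableT mf).
by apply: filterS => t /(_ I) [] /rnorm0_eq0.
Qed.

HB.instance Definition _ := Lmodule_isNormed.Build R[i] L1
  L1_normD L1_normZ L1_norm0_eq0.

End complex_L1.

Section C0.
Context (T : topologicalType) (R : realType).

Definition vanishes_at_infinity (f : T -> R[i]) : Prop :=
  forall e : R, 0 < e ->
    exists2 K : set T, compact K & forall x, ~ K x -> rnorm (f x) < e.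

Definition C0_pred : {pred (T -> R[i])} :=
  [pred f | `[< continuous f /\ vanishes_at_infinity f >]].

Lemma C0_submod_closed : submod_closed C0_pred.
Proof.
split=> [|a f g].
  apply/asboolP; split=> [x|e e0]; first exact: cvg_cst.
  by exists set0 => [|x _]; [exact: compact0|rewrite rnorm0].
move=> /asboolP[cf vf] /asboolP[cg vg]; apply/asboolP; split=> [x|e e0].
  by apply: cvgD; [apply: cvgZr; exact: cf|exact: cg].
have a0 : 0 < rnorm a + 1 by rewrite ltr_wpDl ?rnorm_ge0.
have [K cK fK] := vf _ (divr_gt0 (divr_gt0 e0 (ltr0n R 2)) a0).
have [L cL gL] := vg _ (divr_gt0 e0 (ltr0n R 2)).
exists (K `|` L) => [|x /not_orP[Kx Lx]]; first exact: compactU.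
rewrite -[(a *: f + g) x]/(a * f x + g x) (le_lt_trans (rnormD _ _))//.
rewrite [ltRHS]splitr ltr_leD ?(ltW (gL _ Lx))// rnormM.
rewrite (@le_lt_trans _ _ ((rnorm a + 1) * rnorm (f x)))//.
  by rewrite ler_wpM2r ?rnorm_ge0// lerDl.
by rewrite mulrC -ltr_pdivlMr// fK.
Qed.

HB.instance Definition _ :=
  GRing.isSubmodClosed.Build _ _ C0_pred C0_submod_closed.

Definition C0 : Type := {f : T -> R[i] | f \in C0_pred}.
HB.instance Definition _ := SubChoice.on C0.
HB.instance Definition _ := [SubChoice_isSubLmodule of C0 by <:].
Definition C0_fun (f : C0) : T -> R[i] := val f.
Coercion C0_fun : C0 >-> Funclass.

Lemma rnorm_continuous (f : T -> R[i]) :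
  continuous f -> continuous (fun x => rnorm (f x)).
Proof.
move=> cf x; apply/cvgrPdist_lt => e e0.
have /cvgrPdist_lt/(_ e%:C) := cf x; rewrite ltcR => /(_ e0).
apply: filterS => y; rewrite -rnormE ltcR; apply: le_lt_trans.
have le u v : rnorm u - rnorm v <= rnorm (u - v :> R[i]).
  by rewrite lerBlDr (le_trans _ (rnormD _ _))// subrK.
by rewrite ler_norml lerNl opprB /rnorm (distrC (f x)) !le /rnorm distrC le.
Qed.

Lemma C0_bounded (f : C0) : has_ubound (range (fun x => rnorm (f x))).
Proof.
have /asboolP[cf /(_ 1 ltr01)[K cK fK]] := valP f.
have : bounded_set ((fun x => rnorm (f x)) @` K).
  apply: compact_bounded; apply: continuous_compact => //.
  exact/continuous_subspaceT/rnorm_continuous.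
case=> M [_ /(_ (`|M| + 1))].
have M1 : M < `|M| + 1 by rewrite ltr_pwDr ?ler_norm.
move=> /(_ M1) fM.
exists (`|M| + 1) => _ [x _ <-]; case: (pselect (K x)) => [Kx|/fK/ltW fx1].
  by rewrite (le_trans (ler_norm _))// fM//; exists x.
by rewrite (le_trans fx1)// lerDr.
Qed.

Definition C0_norm (f : C0) : R[i] := (sup (range (fun x => rnorm (f x))))%:C.

Lemma C0_norm_ge (f : C0) x : rnorm (f x) <= sup (range (fun x => rnorm (f x))).
Proof. by apply: ub_le_sup; [exact: C0_bounded|exists x]. Qed.

Lemma C0_sup_ge0 (f : C0) : 0 <= sup (range (fun x => rnorm (f x))).
Proof.
have [->|/set0P[_ [x _ _]]] := eqVneq (range (fun x => rnorm (f x))) set0.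
  by rewrite sup0.
exact: le_trans (rnorm_ge0 _) (C0_norm_ge f x).
Qed.

Lemma C0_sup_le (f : C0) (M : R) : 0 <= M ->
  (forall x, rnorm (f x) <= M) -> sup (range (fun x => rnorm (f x))) <= M.
Proof.
move=> M0 fM.
have [->|/set0P ne] := eqVneq (range (fun x => rnorm (f x))) set0.
  by rewrite sup0.
by apply: ge_sup => // _ [x _ <-].
Qed.

Lemma C0_normD f g : C0_norm (f + g) <= C0_norm f + C0_norm g.
Proof.
rewrite -rmorphD/= lecR; apply: C0_sup_le => [|x].
  by rewrite addr_ge0 ?C0_sup_ge0.
rewrite -[C0_fun (f + g) x]/((f : C0) x + (g : C0) x).
by rewrite (le_trans (rnormD _ _))// lerD ?C0_norm_ge.
Qed.

Lemma C0_normZ a f : C0_norm (a *: f) = `|a| * C0_norm f.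
Proof.
have leZ b h : sup (range (fun x => rnorm ((b *: h : C0) x))) <=
    rnorm b * sup (range (fun x => rnorm ((h : C0) x))).
  apply: C0_sup_le => [|x]; first by rewrite mulr_ge0 ?rnorm_ge0 ?C0_sup_ge0.
  rewrite -[C0_fun (b *: h) x]/(b * (h : C0) x) rnormM.
  by rewrite ler_wpM2l ?rnorm_ge0 ?C0_norm_ge.
rewrite -(rnormE a) -rmorphM/=; congr (_ %:C); apply/eqP; rewrite eq_le leZ/=.
have [->|a0] := eqVneq a 0; first by rewrite rnorm0 mul0r C0_sup_ge0.
have ra0 : 0 < rnorm a by rewrite -ltcR rnormE normr_gt0.
rewrite -ler_pdivlMl// (_ : (rnorm a)^-1 = rnorm a^-1); last first.
  by apply: (mulfI (lt0r_neq0 ra0)); rewrite -rnormM (mulfV a0) rnorm1 divff ?lt0r_neq0.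
by rewrite (le_trans _ (leZ _ _))// scalerA mulVf// scale1r.
Qed.

Lemma C0_norm0_eq0 f : C0_norm f = 0 -> f = 0.
Proof.
move=> /complexI f0; apply/val_inj/funext => x; apply/rnorm0_eq0/eqP.
by rewrite eq_le rnorm_ge0 andbT -[leRHS]f0 C0_norm_ge.
Qed.

HB.instance Definition _ := Lmodule_isNormed.Build R[i] C0
  C0_normD C0_normZ C0_norm0_eq0.

End C0.

(* Abelian groups are written additively: the product of the harmonic analysis
   literature is x + y, the inverse x^-1 is - x.  The alias borel H carries the
   Borel sigma-algebra of H. *)
Section borel.
Variable H : topologicalZmodType.

Definition borel : Type := H.
HB.instance Definition _ := Choice.on borel.
HB.instance Definition _ := isPointed.Build borel (0 : H).
HB.instance Definition _ := Measurable.copy borel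
  (g_sigma_algebraType (@open H : set (set borel))).

End borel.

(* A nonzero translation-invariant Radon measure: finite on compact sets, outer
   regular on Borel sets and inner regular on open sets.  Inner regularity is
   not required of all Borel sets, since it may fail when H is not
   sigma-compact.  The measure is unique up to a positive factor. *)
Definition haar_measure (H : topologicalZmodType) (R : realType)
    (sigma : {measure set (borel H) -> \bar R}) : Prop :=
  [/\ sigma setT != 0%E,
      (forall (x : H) (A : set (borel H)), measurable A ->
         sigma [set x + a | a in (A : set H)] = sigma A),
      (forall K : set H, compact K -> (sigma K < +oo)%E),
      (forall A : set (borel H), measurable A -> sigma A =
         ereal_inf [set sigma U | U in [set U : set H | open U /\ A `<=` U]])
    & (forall U : set H, open U -> sigma U =
         ereal_sup [set sigma K | K in [set K : set H | compact K /\ K `<=` U]])].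

Section dual_group.
Context (H : topologicalZmodType) (R : realType).

Definition character (g : H -> R[i]) : Prop :=
  [/\ continuous g, forall x y, g (x + y) = g x * g y &
      forall x, unit_circle (g x)].

(* The dual group, with the compact-open topology. *)
Definition dual : Type := {g : H -> R[i] | `[< character g >]}.
HB.instance Definition _ := SubChoice.on dual.
Definition dual_fun (g : dual) : H -> R[i] := val g.
Coercion dual_fun : dual >-> Funclass.
HB.instance Definition _ := Topological.copy dual
  (initial_topology (dual_fun : dual -> {compact-open, H -> R[i]})).

Definition fourier (sigma : {measure set (borel H) -> \bar R})
    (f : H -> R[i]) (g : dual) : R[i] :=
  cintegral sigma (fun x : borel H => f x * g (- (x : H))).

End dual_group.

Definition conv_hull (R : realType) (X : normedModType R[i]) (A : set X) :
  set X := smallest (@convex_set R[i] X) A.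

Definition aconv_hull (R : realType) (X : normedModType R[i]) (A : set X) :
  set X := conv_hull [set w *: x | w in unit_circle & x in A].

(* With values in \bar R, so that the distance to the empty set is +oo. *)
Definition dist_to (R : realType) (X : normedModType R[i]) (A : set X)
  (x : X) : \bar R := ereal_inf [set (rnorm (x - a))%:E | a in A].

Section operators.
Context (R : realType) (X Y : normedModType R[i]).

Definition opnorm (T : X -> Y) : \bar R :=
  ereal_sup [set (rnorm (T x))%:E | x in unit_ball X].

Definition lush_operator (G : {linear X -> Y}) : Prop :=
  [/\ continuous G, opnorm G = 1%E &
    forall (x0 : X) (e : R) (y : Y),
      unit_ball X x0 -> 0 < e -> unit_sphere Y y ->
      exists F : set X, [/\ F `<=` unit_ball X,
        conv_hull F `<=` [set x | unit_ball X x /\ 2 - e < rnorm (G x + y)] &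
        (dist_to (aconv_hull F) x0 < e%:E)%E]].

Definition spear_operator (G : {linear X -> Y}) : Prop :=
  forall T : {linear X -> Y}, continuous T ->
    ereal_sup [set opnorm (fun x => G x + w *: T x) | w in unit_circle] =
    (1 + opnorm T)%E.

End operators.

(* Main.v *)
Require Import Defs.
From HB Require Import structures.
From mathcomp Require Import all_boot all_order all_algebra complex.
From mathcomp Require Import all_classical all_reals all_analysis.
From mathcomp Require Import measurable_realfun ring lra.

(* The transform F maps into C0 because it is a contraction for the sup norm and
   indicators of compact sets span a dense subspace of L1, by the regularity of
   the Haar measure.

   For lushness and the spear property, fix a character g and d > 0, and let D
   be the set of f in the unit ball with |F f g| > 1 - d.  Every f in the unit
   ball is a convex combination of elements of D: cut H into finitely many
   pieces on which f(x) g(-x) points in nearly constant direction.  On each of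
   them there is almost no cancellation in the integral defining F f g, so that
   the normalized pieces belong to D, and their norms add up to the norm of f.

   If y in C0 nearly attains its norm 1 at g, then every element of D has a
   unimodular multiple in the convex set of those f in the ball for which F f g
   is close to the phase of y(g), and the absolutely convex hull of this set is
   the whole ball.  For the spear property, |F f g| + |T f g| is bounded by
   S = sup_w ||F + w T|| on the ball, so that |T f g| <= S - 1 + d on D, hence
   on the whole ball. *)

Set Implicit Arguments.
Unset Strict Implicit.
Unset Printing Implicit Defensive.

Import Order.TTheory GRing.Theory Num.Theory.
Import numFieldNormedType.Exports.

Local Notation Re := (@complex.Re _).
Local Notation Im := (@complex.Im _).

Local Open Scope classical_set_scope.
Local Open Scope complex_scope.
Local Open Scope ring_scope.

(** * Complex numbers and complex integrals *)

Section complex_facts.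
Context {R : realType}.
Implicit Types (z w : R[i]) (r : R).

Lemma rnormc_real r : rnorm (r%:C : R[i]) = `|r|.
Proof. by rewrite rnormEc /= expr0n addr0 sqrtr_sqr. Qed.

Lemma Re_le_rnorm z : Re z <= rnorm z.
Proof. exact: le_trans (ler_norm _) (normr_Re_le z). Qed.

Lemma rnormB (X : normedModType R[i]) (x y : X) : rnorm (x - y) = rnorm (y - x).
Proof. by rewrite /rnorm distrC. Qed.

Lemma rnormN (X : normedModType R[i]) (x : X) : rnorm (- x) = rnorm x.
Proof. by rewrite /rnorm normrN. Qed.

Lemma rnormZ (X : normedModType R[i]) (a : R[i]) (x : X) :
  rnorm (a *: x) = rnorm a * rnorm x.
Proof. by apply: complexI; rewrite rmorphM/= !rnormE normrZ. Qed.

Lemma ler_rnorm_sub (X : normedModType R[i]) (x y : X) :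
  rnorm x - rnorm y <= rnorm (x - y).
Proof. by rewrite lerBlDr (le_trans _ (rnormD _ _))// subrK. Qed.

Lemma rnormc_conj z : rnorm (z^* : R[i]) = rnorm z.
Proof. by rewrite !rnormEc; case: z => a b /=; rewrite sqrrN. Qed.

Lemma mulc_conj z : z * z^* = (rnorm z ^+ 2)%:C.
Proof.
rewrite rnormEc sqr_sqrtr ?addr_ge0 ?sqr_ge0//.
by case: z => a b /=; apply/eqP; rewrite eq_complex /= !mulrN opprK; apply/andP;
  split; apply/eqP; ring.
Qed.

Lemma unit_circleP (w : R[i]) : unit_circle w <-> rnorm w = 1.
Proof.
split=> [h|h]; first by apply: complexI; rewrite rnormE.
by rewrite /unit_circle/= -rnormE h.
Qed.

Lemma unit_circle_mulc_conj w : unit_circle w -> w * w^* = 1.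
Proof. by move=> /unit_circleP w1; rewrite mulc_conj w1 expr1n. Qed.

Lemma phaseP z : exists2 w, unit_circle w & w * z = (rnorm z)%:C.
Proof.
have [->|z0] := eqVneq z 0.
  exists 1; first by apply/unit_circleP; rewrite rnorm1.
  by rewrite mulr0 rnorm0.
have rz0 : rnorm z != 0 by apply: contra_neq z0 => /rnorm0_eq0.
exists ((rnorm z)^-1%:C * z^*).
  apply/unit_circleP; rewrite rnormM rnormc_conj rnormc_real ger0_norm ?invr_ge0
    ?rnorm_ge0//.
  by rewrite mulVf.
by rewrite -mulrA [_ * z]mulrC mulc_conj -rmorphM/= expr2 mulKf.
Qed.

Lemma cvgcP {I} (F : set_system I) (FF : Filter F) (f : I -> R[i]) z :
  f @ F --> z <-> forall e : R, 0 < e -> \forall i \near F, rnorm (z - f i) < e.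
Proof.
split=> [/cvgrPdist_lt fz e e0|fz].
  have /fz : 0 < e%:C by rewrite ltcR.
  by apply: filterS => i; rewrite -rnormE ltcR.
(* A positive element of [R[i]] has zero imaginary part, so real radii suffice. *)
apply/cvgrPdist_lt => e; case: e => e ei; rewrite ltcE/= => /andP[/eqP ei0 e0];
  rewrite ei0.
by have := fz _ e0; apply: filterS => i; rewrite -[e +i* 0]/(e%:C) -rnormE ltcR.
Qed.

Lemma Re_continuous : continuous (Re : R[i] -> R).
Proof.
move=> z; apply/(@cvgrPdist_lt _ _ _ _ (nbhs_filter z)) => e e0.
have := (cvgcP (nbhs_filter z) id z).1 cvg_id _ e0.
apply: (@filterS _ _ (nbhs_filter z)) => w; apply: le_lt_trans;
  rewrite (_ : Re z - Re w = Re (z - w)) ?normr_Re_le//.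
by case: (z) (w) => [a b] [c d].
Qed.

Lemma Im_continuous : continuous (Im : R[i] -> R).
Proof.
move=> z; apply/(@cvgrPdist_lt _ _ _ _ (nbhs_filter z)) => e e0.
have := (cvgcP (nbhs_filter z) id z).1 cvg_id _ e0.
apply: (@filterS _ _ (nbhs_filter z)) => w; apply: le_lt_trans;
  rewrite (_ : Im z - Im w = Im (z - w)) ?normr_Im_le//.
by case: (z) (w) => [a b] [c d].
Qed.

Lemma unit_ballP (X : normedModType R[i]) (x : X) :
  unit_ball X x <-> rnorm x <= 1.
Proof. by rewrite /unit_ball/= -rnormE lecR. Qed.

Lemma unit_sphereP (X : normedModType R[i]) (x : X) :
  unit_sphere X x <-> rnorm x = 1.
Proof.
split=> [h|h]; first by apply: complexI; rewrite rnormE.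
by rewrite /unit_sphere/= -rnormE h.
Qed.

Lemma opnorm_ge (X Y : normedModType R[i]) (T : X -> Y) (x : X) :
  rnorm x <= 1 -> ((rnorm (T x))%:E <= opnorm T)%E.
Proof.
by move=> x1; apply: ereal_sup_ubound; exists x => //; exact/unit_ballP.
Qed.

End complex_facts.

Section complex_integral.
Context d (T : measurableType d) (R : realType).
Variable mu : {measure set T -> \bar R}.
Implicit Types f g k : T -> R[i].

Lemma cintegrable_measurable f : cintegrable mu f ->
  measurable_fun setT (Re \o f) /\ measurable_fun setT (Im \o f).
Proof.
by move=> [fr fi]; split; apply/measurable_EFinP;
  [exact: measurable_int fr|exact: measurable_int fi].
Qed.

Lemma cintegrable_rnorm f : cintegrable mu f ->
  mu.-integrable setT (EFin \o (fun x => rnorm (f x))).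
Proof.
move=> fI; have fP : f \in cintegrable_pred mu by apply/asboolP.
exact: (@integrable_rnorm _ _ _ _ (exist _ f fP : L1fun mu)).
Qed.

Lemma le_cintegrable f (g : T -> R) :
  measurable_fun setT (Re \o f) -> measurable_fun setT (Im \o f) ->
  mu.-integrable setT (EFin \o g) -> (forall x, rnorm (f x) <= g x) ->
  cintegrable mu f.
Proof.
move=> mr mi ig fg; split.
- apply: le_integrable ig => //; first exact/measurable_EFinP.
  move=> x _; rewrite /= lee_fin (le_trans (normr_Re_le _))//.
  by rewrite (le_trans (fg x))// ler_norm.
- apply: le_integrable ig => //; first exact/measurable_EFinP.
  move=> x _; rewrite /= lee_fin (le_trans (normr_Im_le _))//.
  by rewrite (le_trans (fg x))// ler_norm.
Qed.

Lemma cintegrableZD a f g : cintegrable mu f -> cintegrable mu g ->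
  cintegrable mu (a *: f + g).
Proof.
move=> fI gI; apply/asboolP.
by apply: (cintegrable_submod_closed mu).2; apply/asboolP.
Qed.

Lemma cintegrable0 : cintegrable mu (0 : T -> R[i]).
Proof. by apply/asboolP; exact: (cintegrable_submod_closed mu).1. Qed.

Lemma cintegrableZ a f : cintegrable mu f -> cintegrable mu (fun x => a * f x).
Proof.
move=> fI; have := cintegrableZD a fI cintegrable0.
by rewrite addr0.
Qed.

Lemma cintegrableD f g : cintegrable mu f -> cintegrable mu g ->
  cintegrable mu (fun x => f x + g x).
Proof. by move=> fI gI; have := cintegrableZD 1 fI gI; rewrite scale1r. Qed.

Lemma RintegralD_RintegralZ (r s : R) (u v : T -> R) :
  mu.-integrable setT (EFin \o u) -> mu.-integrable setT (EFin \o v) ->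
  (\int[mu]_x (r * u x + s * v x) = r * \int[mu]_x u x + s * \int[mu]_x v x)%R.
Proof.
move=> iu iv; rewrite -!RintegralZl// -RintegralD//.
- by apply: eq_integrable (integrableZl measurableT r iu).
- by apply: eq_integrable (integrableZl measurableT s iv).
Qed.

Lemma cintegralZ a f : cintegrable mu f ->
  cintegral mu (fun x => a * f x) = a * cintegral mu f.
Proof.
move=> [fr fi]; apply/eqP; rewrite eq_complex/=; apply/andP; split; apply/eqP.
- rewrite complex_ReM/= -mulNr -RintegralD_RintegralZ//.
  by apply: eq_Rintegral => x _; rewrite complex_ReM mulNr.
- rewrite complex_ImM/= -RintegralD_RintegralZ//.
  by apply: eq_Rintegral => x _; rewrite complex_ImM.
Qed.

Lemma cintegralD f g : cintegrable mu f -> cintegrable mu g ->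
  cintegral mu (fun x => f x + g x) = cintegral mu f + cintegral mu g.
Proof.
move=> [fr fi] [gr gi]; apply/eqP; rewrite eq_complex/=.
apply/andP; split; apply/eqP.
- rewrite -RintegralD//.
  by apply: eq_Rintegral => x _; rewrite complex_ReD.
- rewrite -RintegralD//.
  by apply: eq_Rintegral => x _; rewrite complex_ImD.
Qed.

Lemma cintegrableB f g : cintegrable mu f -> cintegrable mu g ->
  cintegrable mu (fun x => f x - g x).
Proof.
move=> fI gI; rewrite (_ : (fun x => _) = (fun x => f x + (-1) * g x)).
  by apply: cintegrableD => //; exact: cintegrableZ.
by apply/funext => x; ring.
Qed.

Lemma cintegralB f g : cintegrable mu f -> cintegrable mu g ->
  cintegral mu (fun x => f x - g x) = cintegral mu f - cintegral mu g.
Proof.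
move=> fI gI; rewrite -(mulN1r (cintegral mu g)) -cintegralZ// -cintegralD//.
  by congr cintegral; apply/funext => x; rewrite mulN1r.
exact: cintegrableZ.
Qed.

(* Rotate the integral onto the positive real axis. *)
Lemma le_rnorm_cintegral f : cintegrable mu f ->
  rnorm (cintegral mu f) <= (\int[mu]_x rnorm (f x))%R.
Proof.
move=> fI; have [w /unit_circleP w1 wf] := phaseP (cintegral mu f).
rewrite -[leLHS]/(Re (rnorm (cintegral mu f))%:C) -wf -cintegralZ//=.
have [wr _] : cintegrable mu (fun x => w * f x) by exact: cintegrableZ.
apply: le_Rintegral => //; first exact: cintegrable_rnorm.
by move=> x _; rewrite (le_trans (Re_le_rnorm _))// rnormM w1 mul1r.
Qed.

Definition cind (A : set T) : T -> R[i] := fun x => (\1_A x)%:C.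

Lemma rnorm_cind A x : rnorm (cind A x) = \1_A x.
Proof. by rewrite /cind rnormc_real ger0_norm. Qed.

Lemma integrable_indic_lty (A : set T) : measurable A ->
  (mu A < +oo)%E -> mu.-integrable setT (EFin \o (\1_A : T -> R)).
Proof.
move=> mA Aoo; apply/integrableP; split; first exact/measurable_EFinP.
rewrite (eq_integral (fun x => (\1_A x)%:E)) ?integral_indic ?setIT// => x _.
by rewrite /= ger0_norm.
Qed.

Lemma cintegrable_cind A : measurable A -> (mu A < +oo)%E ->
  cintegrable mu (cind A).
Proof.
move=> mA Aoo; apply: (@le_cintegrable _ (\1_A : T -> R)).
- exact: measurable_indic.
- exact: measurable_cst.
- exact: integrable_indic_lty.
- by move=> x; rewrite rnorm_cind.
Qed.

Lemma Rintegral_indic (A : set T) : measurable A ->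
  (\int[mu]_x (\1_A x : R))%R = fine (mu A).
Proof. by move=> mA; rewrite /Rintegral integral_indic// setIT. Qed.

(** Since A and B lie in U, |1_A - 1_B| <= (1_U - 1_A) + (1_U - 1_B) pointwise. Regularity of the
    measure will provide a U that makes the right side small. *)
Lemma cind_L1_dist (A B U : set T) :
  measurable A -> measurable B -> measurable U -> (mu U < +oo)%E ->
  A `<=` U -> B `<=` U ->
  (\int[mu]_x rnorm (cind A x - cind B x) <=
  (fine (mu U) - fine (mu A)) + (fine (mu U) - fine (mu B)))%R.
Proof.
move=> mA mB mU Uoo AU BU.
have Aoo : (mu A < +oo)%E by apply: le_lt_trans Uoo; apply: le_measure;
  rewrite ?inE.
have Boo : (mu B < +oo)%E by apply: le_lt_trans Uoo; apply: le_measure;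
  rewrite ?inE.
have iA := integrable_indic_lty mA Aoo.
have iB := integrable_indic_lty mB Boo.
have iU := integrable_indic_lty mU Uoo.
have iUA := integrableB measurableT iU iA.
have iUB := integrableB measurableT iU iB.
rewrite -!Rintegral_indic// -!RintegralB// -RintegralD//.
apply: le_Rintegral => //.
- by apply/cintegrable_rnorm/cintegrableB; exact: cintegrable_cind.
- have := integrableD measurableT iUA iUB; exact: eq_integrable.
- move=> x _; rewrite /cind -rmorphB/= rnormc_real /= !indicE.
  have [xA|xA] := pselect (A x);
    [rewrite (mem_set xA) (mem_set (AU _ xA))|rewrite (memNset xA)];
    (have [xB|xB] := pselect (B x);
     [rewrite (mem_set xB) ?(mem_set (BU _ xB))|rewrite (memNset xB)]);
    rewrite /= ?(subrr, subr0, sub0r, normr0, normrN, normr1, addr0, add0r)//.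
Qed.

Lemma cintegrable_indic f (S : set T) : cintegrable mu f -> measurable S ->
  cintegrable mu (fun x => f x * (\1_S x)%:C).
Proof.
move=> fI mS; have [mr mi] := cintegrable_measurable fI.
apply: (@le_cintegrable _ (fun x => rnorm (f x))).
- rewrite (_ : _ \o _ = (Re \o f) \* \1_S); first exact: measurable_funM.
  by apply/funext => x; rewrite /= complex_ReM mulr0 subr0.
- rewrite (_ : _ \o _ = (Im \o f) \* \1_S); first exact: measurable_funM.
  by apply/funext => x; rewrite /= complex_ImM mulr0 add0r.
- exact: cintegrable_rnorm.
- move=> x; rewrite rnormM rnormc_real ler_piMr ?rnorm_ge0// indicE.
  by case: (_ \in _); rewrite ?normr1 ?normr0.
Qed.

(** The sectors into which H is cut for lushness are sets of this shape. *)
Lemma measurable_rnorm_le f k (c : R) :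
  cintegrable mu f -> cintegrable mu k ->
  measurable [set x | rnorm (f x) <= c * rnorm (k x)].
Proof.
move=> fI kI.
have mf : measurable_fun setT (fun x => rnorm (f x)).
  by apply/measurable_EFinP/(measurable_int mu); exact: cintegrable_rnorm.
have mk : measurable_fun setT (fun x => c * rnorm (k x)).
  apply: measurable_funM => //.
  by apply/measurable_EFinP/(measurable_int mu); exact: cintegrable_rnorm.
have : measurable
    (setT `&` (fun x => rnorm (f x) <= c * rnorm (k x)) @^-1` [set true]).
  exact: (measurable_fun_ler mf mk).
by rewrite setTI; congr measurable; apply/seteqP; split => x /=.
Qed.

Lemma cintegrable_rnormZ f (u : R[i]) : cintegrable mu f ->
  cintegrable mu (fun x => (rnorm (f x))%:C * u).
Proof.
move=> fI.
rewrite (_ : (fun x => _) = (fun x => u * (rnorm (f x))%:C)); last first.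
  by apply/funext => x; rewrite mulrC.
apply: cintegrableZ; split; first exact: cintegrable_rnorm.
by apply: (eq_integrable _ (cst 0%E)) => //; exact: integrable0.
Qed.

End complex_integral.

(** * The dual group and the Fourier transform of an integrable function *)

Section borel_facts.
Context (H : topologicalZmodType).

Lemma borel_open (U : set H) : open U -> measurable (U : set (borel H)).
Proof. by move=> oU; exact: sub_sigma_algebra. Qed.

Lemma borel_closed (U : set H) : closed U -> measurable (U : set (borel H)).
Proof.
by move=> cU; rewrite -[U]setCK; apply: measurableC; apply: borel_open;
  exact: closed_openC.
Qed.

Lemma continuous_borel_measurable (R : realType) (u : H -> R) :
  continuous u -> measurable_fun setT (u : borel H -> R).
Proof.
move=> /continuousP cu; apply: (measurability _ (RGenOpens.measurableE R)).
move=> _ [_ [a [b ->] <-]]; rewrite setTI.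
by apply: borel_open; apply: cu; exact: interval_open.
Qed.

Lemma continuous_borel_borel_measurable (u : H -> H) :
  continuous u -> measurable_fun setT (u : borel H -> borel H).
Proof.
move=> /continuousP cu.
apply: (@measurability _ _ (borel H) (borel H) setT u
  (@open H : set (set (borel H)))) => //.
by move=> _ [U oU <-]; rewrite setTI; apply: borel_open; exact: cu.
Qed.

Lemma translate_continuous (w : H) : continuous (fun x : H => x + w).
Proof.
move=> x; apply: (@continuous_comp _ _ _ (fun x : H => (x, w))
  (fun x : H * H => x.1 + x.2)); last exact: add_continuous.
by apply: cvg_pair => /=; [exact: cvg_id|exact: cvg_cst].
Qed.

Context (R : realType) (sigma : {measure set (borel H) -> \bar R}).

Lemma cintegrable_mul (f : borel H -> R[i]) (k : H -> R[i]) (M : R) :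
  cintegrable sigma f -> continuous k -> (forall x, rnorm (k x) <= M) ->
  cintegrable sigma (fun x : borel H => f x * k (x : H)).
Proof.
move=> fI ck kM; have [mr mi] := cintegrable_measurable fI.
have mkr : measurable_fun setT ((Re \o k) : borel H -> R).
  by apply: continuous_borel_measurable => x; apply: continuous_comp;
    [exact: ck|exact: Re_continuous].
have mki : measurable_fun setT ((Im \o k) : borel H -> R).
  by apply: continuous_borel_measurable => x; apply: continuous_comp;
    [exact: ck|exact: Im_continuous].
apply: (@le_cintegrable _ _ _ _ _ (fun x => M * rnorm (f x))).
- rewrite (_ : _ \o _ = (fun x : borel H =>
    Re (f x) * Re (k x) - Im (f x) * Im (k x))).
    by apply: measurable_funB; exact: measurable_funM.
  by apply/funext => x; exact: complex_ReM.
- rewrite (_ : _ \o _ = (fun x : borel H =>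
    Re (f x) * Im (k x) + Im (f x) * Re (k x))).
    by apply: measurable_funD; exact: measurable_funM.
  by apply/funext => x; exact: complex_ImM.
- by have := integrableZl measurableT M (cintegrable_rnorm fI);
    exact: eq_integrable.
- by move=> x; rewrite rnormM mulrC ler_wpM2r ?rnorm_ge0.
Qed.

End borel_facts.

Local Notation borel_cind K := (cind _ (K : set (borel _))).

Section dual_facts.
Context (H : topologicalZmodType) (R : realType).
Implicit Types g : dual H R.

Lemma dualP g : character g.
Proof. exact/asboolP/(valP g). Qed.

Lemma dual_continuous g : continuous g.
Proof. by have [] := dualP g. Qed.

Lemma dualD g x y : g (x + y) = g x * g y.
Proof. by have [] := dualP g. Qed.

Lemma dual_rnorm g x : rnorm (g x) = 1.
Proof. by have [_ _ /(_ x)/unit_circleP] := dualP g. Qed.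

Lemma dual_neq0 g x : g x != 0.
Proof.
apply/eqP => h; have := dual_rnorm g x.
by rewrite h rnorm0 => /esym/eqP; rewrite oner_eq0.
Qed.

Lemma dual0 g : g 0 = 1.
Proof. by apply: (mulfI (dual_neq0 g 0)); rewrite -dualD addr0 mulr1. Qed.

Lemma dualN g x : g x * g (- x) = 1.
Proof. by rewrite -dualD subrr dual0. Qed.

Lemma dual_opp_continuous g : continuous (fun x => g (- x)).
Proof.
move=> x; apply: (@continuous_comp _ _ _ -%R g); first exact: opp_continuous.
exact: dual_continuous.
Qed.

Context (sigma : {measure set (borel H) -> \bar R}).
Implicit Types f : borel H -> R[i].

Lemma cintegrable_twist f g : cintegrable sigma f ->
  cintegrable sigma (fun x : borel H => f x * g (- (x : H))).
Proof.
move=> fI; apply: (@cintegrable_mul _ _ _ _ (fun x => g (- x)) 1) => //.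
  exact: dual_opp_continuous.
by move=> x; rewrite dual_rnorm.
Qed.

Lemma fourierZD a f1 f2 : cintegrable sigma f1 -> cintegrable sigma f2 ->
  fourier sigma (a *: f1 + f2) =
  a *: (fourier sigma f1 : dual H R -> R[i]) + fourier sigma f2.
Proof.
move=> i1 i2; apply/funext => g.
rewrite -[RHS]/(a * fourier sigma f1 g + fourier sigma f2 g) /fourier.
rewrite -cintegralZ; last exact: cintegrable_twist.
rewrite -cintegralD; last 2 first.
- by apply: cintegrableZ; exact: cintegrable_twist.
- exact: cintegrable_twist.
congr cintegral; apply/funext => x.
by rewrite -[(a *: f1 + f2) x]/(a * f1 x + f2 x) mulrDl mulrA.
Qed.

Lemma le_rnorm_fourier f g : cintegrable sigma f ->
  rnorm (fourier sigma f g) <= (\int[sigma]_x rnorm (f x))%R.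
Proof.
move=> fI; apply: le_trans (le_rnorm_cintegral (cintegrable_twist g fI)) _.
apply: le_Rintegral => //.
- exact/cintegrable_rnorm/cintegrable_twist.
- exact: cintegrable_rnorm.
- by move=> x _; rewrite rnormM dual_rnorm mulr1.
Qed.

Lemma fourierB f1 f2 g : cintegrable sigma f1 -> cintegrable sigma f2 ->
  fourier sigma (fun x => f1 x - f2 x) g =
  fourier sigma f1 g - fourier sigma f2 g.
Proof.
move=> i1 i2; rewrite /fourier -cintegralB; [|exact: cintegrable_twist..].
by congr cintegral; apply/funext => x; rewrite mulrBl.
Qed.

Lemma rnorm_fourierB f1 f2 g : cintegrable sigma f1 -> cintegrable sigma f2 ->
  rnorm (fourier sigma f1 g - fourier sigma f2 g) <=
  (\int[sigma]_x rnorm (f1 x - f2 x))%R.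
Proof.
by move=> i1 i2; rewrite -fourierB//; exact/le_rnorm_fourier/cintegrableB.
Qed.

End dual_facts.

(** * Compact sets of characters *)

Section compact_square.
Context {R : realType}.

Lemma complex_of_pair_continuous :
  continuous (fun p : R * R => p.1 +i* p.2 : R[i]).
Proof.
move=> [a b]; apply/(cvgcP (nbhs_filter (a, b))) => e e0.
have e20 : 0 < e / 2 by rewrite divr_gt0.
exists (ball a (e / 2), ball b (e / 2)); first by split; exact: nbhsx_ballx.
move=> [c d] [/= ac bd]; apply: le_lt_trans (rnorm_le_ReIm _) _ => /=.
by rewrite [ltRHS]splitr ltrD.
Qed.

Lemma compact_complex_square : compact
  [set z : R[i] | - 1 <= Re z <= 1 /\ - 1 <= Im z <= 1].
Proof.
rewrite (_ : mkset _ =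
    (fun p : R * R => p.1 +i* p.2 : R[i]) @` (`[- 1, 1] `*` `[- 1, 1])).
  apply: continuous_compact.
    exact/continuous_subspaceT/complex_of_pair_continuous.
  by apply: compact_setX; exact: segment_compact.
apply/seteqP; split=> [[a b] /= [ha hb]|_ [[a b] [/= ha hb] <-]].
  by exists (a, b); rewrite //= !in_itv.
by rewrite !in_itv in ha hb.
Qed.

End compact_square.

Section dual_compactness.
Context (H : topologicalZmodType) (R : realType).

(* The square containing the circle being compact, an ultrafilter of characters
   has a pointwise limit; equicontinuity makes this limit continuous and
   upgrades the convergence to the compact-open topology. *)
Lemma dual_compact (A : set (dual H R)) : closed A ->
  (forall e : R, 0 < e -> \forall w \near (0 : H), forall g, A g ->
     rnorm (g w - 1) <= e) ->
  compact A.
Proof.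
move=> cA eqcA; rewrite compact_ultra => F UF FA.
have FF : ProperFilter F by exact: ultra_proper.
have ptlim (x : H) : exists z : R[i], (fun g : dual H R => g x) @ F --> z.
  have [] := @compact_complex_square R ((fun g : dual H R => g x) @ F) _.
    apply: (@filterS _ F _ A _ _ FA) => g _ /=;
      rewrite -!ler_norml -(dual_rnorm g x).
    by split; [exact: normr_Re_le|exact: normr_Im_le].
  (* A cluster point of an ultrafilter is its limit: if B were not in the image filter, its
     complement would be, and would have to meet B. *)
  move=> z [_ zF]; exists z => B zB; have FB s Fs := zF s B Fs zB.
  have [//|FCB] := in_ultra_setVsetC [set g : dual H R | B (g x)] UF.
  by have [y []] := FB (~` B) FCB.
have [h Fh] := choice ptlim.
have equi x (e : R) : 0 < e ->
    \forall y \near x, forall g, A g -> rnorm (g x - g y) <= e.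
  move=> e0; have h0 : (fun y => y - x) @ x --> (0 : H).
    by rewrite -(subrr x); exact: translate_continuous.
  have := h0 _ (eqcA e e0); apply: (@filterS _ _ (nbhs_filter x)) =>
    y /= + g gA => /(_ g gA).
  (* As |g x| = 1, |g x - g y| equals |g (y - x) - 1|, so equicontinuity at 0 spreads to every
     point. *)
  move=> gyx; rewrite rnormB -[in g y](subrK x y) dualD -[X in _ - X]mul1r.
  by rewrite -mulrBl rnormM dual_rnorm mulr1.
have hch : character h.
  split.
  - move=> x; apply/(cvgcP (nbhs_filter x)) => e e0.
    have e20 : 0 < e / 2 by rewrite divr_gt0.
    apply: filterS (equi x _ e20) => y Ay.
    have e80 : 0 < e / 8 by rewrite divr_gt0.
    have Fx := (cvgcP FF _ _).1 (Fh x) _ e80.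
    have Fy := (cvgcP FF _ _).1 (Fh y) _ e80.
    have [g [Ag [/= gx gy]]] : exists g : dual H R,
        (A `&` ([set g | rnorm (h x - g x) < e / 8] `&`
                [set g | rnorm (h y - g y) < e / 8])) g.
      exact: (@filter_ex _ F _ _ (filterI FA (filterI Fx Fy))).
    have -> : h x - h y = (h x - g x) + (g x - g y) + (g y - h y) by ring.
    rewrite rnormB in gy.
    have := Ay _ Ag; have := rnormD (h x - g x + (g x - g y)) (g y - h y).
    have := rnormD (h x - g x) (g x - g y); lra.
  - move=> x y; apply: (cvg_unique (@norm_hausdorff _ R[i]) (Fh (x + y))).
    rewrite (_ : (fun g : dual H R => g (x + y)) = (fun g => g x * g y)).
      exact: cvgM (Fh x) (Fh y).
    by apply/funext => g; exact: dualD.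
  - move=> x; apply: (cvg_unique (@norm_hausdorff _ R[i]) (cvg_norm (Fh x))).
    rewrite (_ : (fun g : dual H R => _) = cst 1); last first.
      by apply/funext => g; rewrite -rnormE dual_rnorm.
    exact: cvg_cst.
pose h' : dual H R := exist _ h (asboolT hch).
have Fh' : F --> h'.
  move=> B /= [_ [[C oC <-] Ch' sCB]].
  suff hF :
      (dual_fun (R := R) : dual H R -> {compact-open, H -> R[i]}) @ F -->
      (h : {compact-open, H -> R[i]}).
    have FC := hF C (open_nbhs_nbhs (conj oC Ch')).
    exact: (@filterS _ F _ _ _ sCB FC).
  (* Compact-open convergence to a continuous limit is uniform convergence on compact sets; on the
     equicontinuous family [A] it follows from pointwise convergence. *)
  apply/compact_open_fam_compactP; first by have [] := hch.
  apply/pointwise_compact_cvg.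
    apply/near_powerset_filter_fromP; first exact: equicontinuous_subset_id.
    exists ((dual_fun (R := R) : dual H R -> H -> R[i]) @` A).
      by apply: (@filterS _ F _ A _ _ FA) => g Ag; exists g.
    move=> x E; rewrite -entourage_from_ballE => -[e /= e0 eE].
    have e20 : 0 < Re e / 2.
      by move: e0; rewrite ltcE => /andP[_ e0]; rewrite divr_gt0.
    apply: (@filterS _ _ (nbhs_filter x) _ _ _ (equi x _ e20)) =>
      y Ay _ [g Ag <-].
    apply: eE => /=; rewrite /ball/= -rnormE.
    have -> : e = (Re e)%:C by rewrite RRe_real// gtr0_real.
    rewrite ltcR; apply: le_lt_trans (Ay _ Ag) _.
    by rewrite ltr_pdivrMr// ltr_pMr ?ltr1n//; lra.
  apply/pointwise_cvgP => x; exact: Fh.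
exists h'; split => //.
apply: cA => B /Fh' FB.
exact: (@filter_ex _ F _ _ (filterI FA FB)).
Qed.

End dual_compactness.

(** * The Riemann-Lebesgue lemma *)

Section C0_facts.
Context (T : topologicalType) (R : realType).

Lemma C0_uniform_limit (f : T -> R[i]) :
  (forall e : R, 0 < e -> exists2 h : T -> R[i], h \in @C0_pred T R &
     forall x, rnorm (f x - h x) <= e) ->
  f \in @C0_pred T R.
Proof.
move=> fh; apply/asboolP; split=> [x|e e0].
  apply/(cvgcP (nbhs_filter x)) => e e0.
  have e40 : 0 < e / 4 by rewrite divr_gt0.
  have [h /asboolP[ch _] hf] := fh _ e40.
  have := (cvgcP (nbhs_filter x) _ _).1 (ch x) _ e40.
  apply: filterS => y hxy.
  have -> : f x - f y = (f x - h x) + (h x - h y) + (h y - f y) by ring.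
  have := hf x; have := hf y; rewrite (rnormB (f y)) => fy fx.
  have := rnormD (f x - h x + (h x - h y)) (h y - f y).
  have := rnormD (f x - h x) (h x - h y); lra.
have e40 : 0 < e / 4 by rewrite divr_gt0.
have [h /asboolP[_ vh] hf] := fh _ e40.
have [K cK hK] := vh _ e40; exists K => // x /hK hx.
have := hf x; have := rnormD (f x - h x) (h x); rewrite subrK; lra.
Qed.

End C0_facts.

(** * Continuity of transforms of indicators, and translations *)

Section fourier_translation.
Context (H : topologicalZmodType) (R : realType).
Context (sigma : {measure set (borel H) -> \bar R}).
Implicit Types (f : borel H -> R[i]) (g : dual H R).

Lemma dual_near_compact (g : dual H R) (K : set H) (e : R) :
  compact K -> 0 < e ->
  \forall g' \near g, forall x, K x ->
    rnorm (g (- x) - (g' : dual H R) (- x)) < e.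
Proof.
move=> cK e0.
(* The transform evaluates characters at - x, so uniform closeness is needed on the reflected
   compact set. *)
have cNK : compact (-%R @` K).
  by apply: continuous_compact => //; apply: continuous_subspaceT;
    exact: opp_continuous.
have gg : (dual_fun (R := R) : dual H R -> {compact-open, H -> R[i]}) @ g -->
    (dual_fun g : {compact-open, H -> R[i]}) by exact: initial_continuous.
have /compact_open_fam_compactP := gg.
move=> /(_ (@dual_continuous _ _ g)) gg'.
have ee : entourage [set p : R[i] * R[i] | ball p.1 e%:C p.2].
  by rewrite -entourage_from_ballE; exists e%:C => //=; rewrite ltcR.
have := gg' (fmap_filter _ (nbhs_filter g)) _ (fam_nbhs (dual_fun g) ee cNK).
apply: (@filterS _ _ (nbhs_filter g)) => g' /= h x Kx.
have := h (- x) (ex_intro2 _ _ x Kx erefl).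
by rewrite /ball/= -rnormE ltcR.
Qed.

Lemma cintegrable_twistB f g g' : cintegrable sigma f ->
  cintegrable sigma (fun x : borel H => f x * (g (- (x : H)) - g' (- (x : H)))).
Proof.
move=> fI; under eq_fun do rewrite mulrBr.
by apply: cintegrableB; exact: cintegrable_twist.
Qed.

Lemma rnorm_fourierB_dual f g g' : cintegrable sigma f ->
  rnorm (fourier sigma f g - fourier sigma f g') <=
  (\int[sigma]_x rnorm (f x * (g (- (x : H)) - g' (- (x : H)))))%R.
Proof.
move=> fI; rewrite /fourier -cintegralB; [|exact: cintegrable_twist..].
under eq_fun do rewrite -mulrBr.
exact/le_rnorm_cintegral/cintegrable_twistB.
Qed.

Lemma fourier_cind_continuous (K : set H) : compact K ->
  measurable (K : set (borel H)) ->
  (sigma K < +oo)%E ->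
  continuous (fourier sigma (borel_cind K) : dual H R -> R[i]).
Proof.
move=> cK mK Koo g; apply/(cvgcP (nbhs_filter g)) => e e0.
have s0 : 0 <= fine (sigma K) by rewrite fine_ge0.
(* The + 1 covers the case of measure 0; the integral will be at most c times the measure of K,
   which is below e. *)
pose c := e / (fine (sigma K) + 1).
have c0 : 0 < c by rewrite divr_gt0// ltr_wpDl.
have ce : c * fine (sigma K) < e.
  by rewrite /c mulrAC ltr_pdivrMr ?ltr_wpDl// mulrDr mulr1 ltrDl.
apply: (@filterS _ _ (nbhs_filter g) _ _ _ (dual_near_compact g cK c0)) =>
  g' gg'.
have KI := cintegrable_cind mK Koo.
apply: le_lt_trans (rnorm_fourierB_dual g g' KI) _.
apply: le_lt_trans ce.
rewrite -Rintegral_indic// -RintegralZl//; last exact: integrable_indic_lty.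
apply: le_Rintegral => //.
- exact/cintegrable_rnorm/cintegrable_twistB.
- have := integrableZl measurableT c (integrable_indic_lty mK Koo).
  exact: eq_integrable.
- move=> x _; rewrite rnormM rnorm_cind indicE; case: (boolP (x \in _));
    last by rewrite !(mulr0, mul0r).
  by rewrite inE => Kx; rewrite mul1r mulr1 ltW// gg'.
Qed.

Hypothesis translate_sigma : forall (x : H) (A : set (borel H)), measurable A ->
  sigma [set x + a | a in (A : set H)] = sigma A.

Lemma translate_preimage (w : H) (A : set (borel H)) : measurable A ->
  sigma ((fun x : borel H => ((x : H) + w : borel H)) @^-1` A) = sigma A.
Proof.
move=> mA; rewrite -[RHS](translate_sigma (- w))//; congr (sigma _).
apply/seteqP; split=> [x Ax|_ [a Aa <-]];
  last by rewrite /= addrC addrA subrr add0r.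
by exists (x + w : H) => //; rewrite addrC addrK.
Qed.

Lemma measurable_translate (w : H) :
  measurable_fun setT (fun x : borel H => ((x : H) + w : borel H)).
Proof.
by apply: continuous_borel_borel_measurable; exact: translate_continuous.
Qed.

(** Change of variables along a translation, whose image measure is [sigma] again. The nonnegative
    case comes first because it yields the integrability of translates, which the general case
    requires. *)
Lemma ge0_integral_translate (v : borel H -> \bar R) (w : H) :
  measurable_fun setT v -> (forall x, 0 <= v x)%E ->
  (\int[sigma]_x v ((x : H) + w)%R = \int[sigma]_x v x)%E.
Proof.
move=> mv v0; pose t := fun x : borel H => (x : H) + w : borel H.
have := @ge0_integral_pushforward _ _ _ _ R t
  (measurable_translate w) sigma setT v
  measurableT mv (fun x _ => v0 x).
rewrite preimage_setT => <-.
by apply: eq_measure_integral => [|? A mA _];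
  [exact: measurable_translate|exact: translate_preimage].
Qed.

Lemma integrable_translate (u : borel H -> R) (w : H) :
  sigma.-integrable setT (EFin \o u) ->
  sigma.-integrable setT (EFin \o (fun x : borel H => u ((x : H) + w))).
Proof.
move=> /integrableP[mu ui]; have mw := measurable_translate w.
apply/integrableP; split; first exact: (measurableT_comp mu mw).
apply: le_lt_trans ui; rewrite le_eqVlt; apply/orP; left; apply/eqP.
apply: (@ge0_integral_translate (fun x => `|(u x)%:E|)%E) => //.
exact: measurableT_comp.
Qed.

Lemma Rintegral_translate (u : borel H -> R) (w : H) :
  sigma.-integrable setT (EFin \o u) ->
  (\int[sigma]_x u ((x : H) + w) = \int[sigma]_x u x)%R.
Proof.
move=> iu; pose t := fun x : borel H => (x : H) + w : borel H.
have mu : measurable_fun setT (EFin \o u) by exact: measurable_int iu.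
have := @integral_pushforward _ _ _ _ R t (measurable_translate w) sigma setT
  (EFin \o u) mu (integrable_translate w iu) measurableT.
rewrite preimage_setT /Rintegral => <-; congr fine.
by apply: eq_measure_integral => [|? A mA _];
  [exact: measurable_translate|exact: translate_preimage].
Qed.

Lemma cintegrable_translate f (w : H) : cintegrable sigma f ->
  cintegrable sigma (fun x : borel H => f ((x : H) + w)).
Proof.
by move=> [fr fi]; split;
  [exact: (integrable_translate w fr)|exact: (integrable_translate w fi)].
Qed.

Lemma cintegral_translate f (w : H) : cintegrable sigma f ->
  cintegral sigma (fun x : borel H => f ((x : H) + w)) = cintegral sigma f.
Proof.
move=> [fr fi]; apply/eqP; rewrite eq_complex; apply/andP; split; apply/eqP.
  exact: (Rintegral_translate w fr).
exact: (Rintegral_translate w fi).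
Qed.

(** The integrand f (x + w) g (- x) is g w times f (x + w) g (- (x + w)), and invariance of the
    measure removes the shift. *)
Lemma fourier_translate f (w : H) g : cintegrable sigma f ->
  fourier sigma (fun x : borel H => f ((x : H) + w)) g =
  g w * fourier sigma f g.
Proof.
move=> fI; have gI := cintegrable_twist g fI.
rewrite /fourier -(cintegral_translate w gI) -cintegralZ.
  congr cintegral; apply/funext => x.
  by rewrite opprD dualD -[LHS]mulr1 -(dualN g w); ring.
exact: (cintegrable_translate w gI).
Qed.

(** (g w - 1) F f g is the transform at g of x |-> f (x + w) - f x. *)
Lemma le_fourier_translate f (w : H) g : cintegrable sigma f ->
  rnorm (g w - 1) * rnorm (fourier sigma f g) <=
  (\int[sigma]_x rnorm (f ((x : H) + w) - f x))%R.
Proof.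
move=> fI; rewrite -rnormM mulrBl mul1r -fourier_translate//.
by apply: rnorm_fourierB => //; exact: cintegrable_translate.
Qed.

End fourier_translation.

(** The near-covering form of compactness merges the neighbourhoods of 0 that work near each point
    of K into a single one. *)
Lemma near_translate_compact (H : topologicalZmodType) (K V : set H) :
  compact K -> open V -> K `<=` V ->
  \forall w \near (0 : H), forall x, K x -> V (x + w) /\ V (x - w).
Proof.
move=> /compact_near_coveringP cK oV KV.
have N0 := nbhs_filter (0 : H).
have hp : \forall w \near (0 : H), K `<=` (fun x => V (x + w)).
  apply: cK => x Kx.
  have : nbhs (x + 0) V by rewrite addr0; apply: open_nbhs_nbhs; split => //;
    exact: KV.
  by move=> /(@add_continuous H (x, 0)).
have hm : \forall w \near (0 : H), K `<=` (fun x => V (x - w)).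
  apply: cK => x Kx.
  have : nbhs (x - 0) V by rewrite subr0; apply: open_nbhs_nbhs; split => //;
    exact: KV.
  by move=> /(@sub_continuous H (x, 0)).
apply: (@filterS2 _ _ N0 _ _ _ _ hp hm) => w hpw hmw x Kx.
by split; [exact: hpw|exact: hmw].
Qed.

(** * Regularity of the Haar measure and indicators of compact sets *)

Section haar_regularity.
Context (H : topologicalZmodType) (R : realType).
Context (sigma : {measure set (borel H) -> \bar R}).
Implicit Types (f : borel H -> R[i]) (g : dual H R).

Context (haar : haar_measure sigma) (hausH : hausdorff_space H).

Let translate_sigma : forall (x : H) (A : set (borel H)), measurable A ->
  sigma [set x + a | a in (A : set H)] = sigma A.
Proof. by case: haar. Qed.

Lemma haar_compact_lty (K : set H) : compact K -> (sigma K < +oo)%E.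
Proof. by case: haar => _ _ + _ _; exact. Qed.

Lemma haar_compact_measurable (K : set H) : compact K ->
  measurable (K : set (borel H)).
Proof. by move=> cK; apply: borel_closed; exact: compact_closed. Qed.

Lemma haar_outer (A : set (borel H)) (e : R) : measurable A ->
  (sigma A < +oo)%E -> 0 < e ->
  exists U : set H, [/\ open U, A `<=` U, (sigma U < +oo)%E &
    fine (sigma U) < fine (sigma A) + e].
Proof.
move=> mA Aoo e0.
have fA : sigma A \is a fin_num by rewrite ge0_fin_numE.
have [_ _ _ outer _] := haar.
have [] := @lb_ereal_inf_adherent R
  [set sigma U | U in [set U : set H | open U /\ A `<=` U]] e e0.
  by rewrite -outer.
rewrite -outer// => _ [U [oU AU] <-] UA.
have Uoo : (sigma U < +oo)%E.
  by apply: lt_trans UA _; rewrite -(fineK fA) -EFinD ltry.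
exists U; split => //; rewrite -lte_fin EFinD !fineK// ge0_fin_numE//.
Qed.

Lemma haar_inner (U : set H) (e : R) : open U -> (sigma U < +oo)%E ->
  0 < e -> exists K : set H,
    [/\ compact K, K `<=` U & fine (sigma U) - e < fine (sigma K)].
Proof.
move=> oU Uoo e0.
have fU : sigma U \is a fin_num by rewrite ge0_fin_numE.
have [_ _ _ _ inner] := haar.
have [] := @ub_ereal_sup_adherent R
  [set sigma K | K in [set K : set H | compact K /\ K `<=` U]] e e0.
  by rewrite -inner.
rewrite -inner// => _ [K [cK KU] <-] UK.
exists K; split => //; rewrite -lte_fin EFinB !fineK// ge0_fin_numE//.
exact: haar_compact_lty.
Qed.

(** Enclose K in an open V of measure below that of K plus e / 2. For small w the translate of K
    also lies in V and has the measure of K, so that both are within e / 2 of V in L1. *)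
Lemma haar_translate_compact (K : set H) (e : R) : compact K -> 0 < e ->
  \forall w \near (0 : H),
    (\int[sigma]_x rnorm (borel_cind K ((x : H) + w) - borel_cind K x : R[i])
     <= e)%R.
Proof.
move=> cK e0; have mK := haar_compact_measurable cK;
  have Koo := haar_compact_lty cK.
have e20 : 0 < e / 2 by rewrite divr_gt0.
have [V [oV KV Voo VK]] := haar_outer mK Koo e20.
have mV := borel_open oV.
apply: (@filterS _ _ (nbhs_filter (0 : H)) _ _ _
  (near_translate_compact cK oV KV)) => w hw.
pose B := (fun x : borel H => (x : H) + w : borel H) @^-1` K.
have mB : measurable B by rewrite -[B]setTI; exact: measurable_translate.
have sB : sigma B = sigma K by exact: translate_preimage.
have BV : B `<=` V by move=> x /hw[_]; rewrite addrK.
apply: le_trans (cind_L1_dist mB mK mV Voo BV KV) _.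
by rewrite sB; lra.
Qed.

(* Since g w * F f g is the transform of x |-> f (x + w), continuity of
   translations in L1 bounds |g w - 1| uniformly over the characters g with
   |F f g| >= e, which are therefore equicontinuous. *)
Lemma fourier_cind_compact_C0 (K : set H) : compact K ->
  (fourier sigma (borel_cind K) : dual H R -> R[i]) \in @C0_pred (dual H R) R.
Proof.
move=> cK; have mK := haar_compact_measurable cK;
  have Koo := haar_compact_lty cK.
have KI := cintegrable_cind mK Koo.
have cF := @fourier_cind_continuous H R sigma _ cK mK Koo.
apply/asboolP; split => // e e0.
exists [set g : dual H R | e <= rnorm (fourier sigma (borel_cind K) g)];
  last first.
  by move=> g /negP; rewrite -ltNge.
apply: dual_compact.
  apply: (@closed_comp _ _ (fun g : dual H R =>
    rnorm (fourier sigma (borel_cind K) g)) [set x | e <= x]).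
    by move=> g _; exact: rnorm_continuous.
  exact: closed_ge.
(* Where |F g| >= e, the bound d * e on |g w - 1| |F g| gives |g w - 1| <= d. *)
move=> d d0; have de0 : 0 < d * e by rewrite mulr_gt0.
apply: (@filterS _ _ (nbhs_filter (0 : H)) _ _ _
  (haar_translate_compact cK de0)) => w hw g /= eg.
have wF := le_trans (le_fourier_translate translate_sigma w g KI) hw.
have eF : rnorm (g w - 1) * e <=
    rnorm (g w - 1) * rnorm (fourier sigma (borel_cind K) g).
  by rewrite ler_wpM2l ?rnorm_ge0.
by have := le_trans eF wF; rewrite ler_pM2r.
Qed.

End haar_regularity.

Import HBSimple.

(** * From indicators to all integrable functions *)

Section fourier_all.
Context (H : topologicalZmodType) (R : realType).
Context (sigma : {measure set (borel H) -> \bar R}).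
Context (haar : haar_measure sigma) (hausH : hausdorff_space H).
Implicit Types (f : borel H -> R[i]) (g : dual H R).

(** This class is closed under linear combinations and L1 limits; once it contains the indicators of
    sets of finite measure, it is all of L1. *)
Let C0F f : Prop := cintegrable sigma f /\
  (fourier sigma f : dual H R -> R[i]) \in @C0_pred (dual H R) R.

Let C0F_ZD a f1 f2 : C0F f1 -> C0F f2 -> C0F (fun x => a * f1 x + f2 x).
Proof.
move=> [i1 c1] [i2 c2]; split.
  by apply: cintegrableD => //; exact: cintegrableZ.
have -> : fourier sigma (fun x => a * f1 x + f2 x) =
    a *: (fourier sigma f1 : dual H R -> R[i]) + fourier sigma f2.
  by rewrite -fourierZD.
exact: (@C0_submod_closed (dual H R) R).2.
Qed.

Let C0F_0 : C0F (fun=> 0).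
Proof.
split; first exact: cintegrable0.
rewrite (_ : fourier _ _ = (0 : dual H R -> R[i]));
  first exact: (@C0_submod_closed (dual H R) R).1.
apply/funext => g; apply: rnorm0_eq0; apply/eqP; rewrite eq_le rnorm_ge0 andbT.
apply: le_trans (le_rnorm_fourier g (cintegrable0 sigma)) _.
by under eq_Rintegral do rewrite rnorm0; rewrite Rintegral_cst// mul0r.
Qed.

(** An L1 approximation of f gives a uniform approximation of its transform, and C0 is closed under
    uniform limits. *)
Let C0F_approx f : cintegrable sigma f ->
  (forall e : R, 0 < e -> exists2 h, C0F h &
    (\int[sigma]_x rnorm (f x - h x) <= e)%R) -> C0F f.
Proof.
move=> fI fh; split => //; apply: C0_uniform_limit => e e0.
have [h [hI hC] fhe] := fh _ e0; exists (fourier sigma h) => // g.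
exact: le_trans (rnorm_fourierB g fI hI) fhe.
Qed.

(** Outer regularity encloses A in an open U of nearly the same measure, and inner regularity finds
    a compact K in U. K need not lie in A: both are L1-close to U, hence to each other. *)
Let C0F_cind (A : set (borel H)) : measurable A -> (sigma A < +oo)%E ->
  C0F (cind R A).
Proof.
move=> mA Aoo; apply: C0F_approx => [|e e0]; first exact: cintegrable_cind.
have e20 : 0 < e / 2 by rewrite divr_gt0.
have [U [oU AU Uoo UA]] := haar_outer haar mA Aoo e20.
have [K [cK KU UK]] := haar_inner haar oU Uoo e20.
have mK := haar_compact_measurable hausH cK.
exists (borel_cind K).
  split; last exact: fourier_cind_compact_C0.
  by apply: cintegrable_cind => //; exact: haar_compact_lty.
by apply: le_trans (cind_L1_dist mA mK (borel_open oU) Uoo AU KU) _; lra.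
Qed.

Let C0F_sfun (u : {sfun borel H >-> R}) :
  sigma.-integrable setT (EFin \o u) -> C0F (fun x => (u x)%:C).
Proof.
move=> iu.
have C0F1 y : C0F (fun x => (y * \1_(u @^-1` [set y]) x)%:C).
  (* The level set of 0 may have infinite measure, but its term vanishes. *)
  have [->|y0] := eqVneq y 0.
    rewrite (_ : (fun x => _) = fun=> 0); first exact: C0F_0.
    by apply/funext => x; rewrite mul0r.
  have mA : measurable (u @^-1` [set y]) by exact: measurable_funPTI.
  have Aoo : (sigma (u @^-1` [set y]) < +oo)%E.
    have iy : sigma.-integrable setT
        (EFin \o (\1_(u @^-1` [set y]) : borel H -> R)).
      (* Chebyshev: the indicator of the level set of y != 0 is dominated by |u| / |y|. *)
      apply: le_integrable (integrableZl measurableT `|y|^-1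
        (integrable_abse iu)) => //.
        exact/measurable_EFinP/measurable_indic.
      move=> x _; rewrite /= lee_fin indicE normrM normrV ?unitfE ?normr_eq0//
        !normr_id.
      have [xA|xA] := pselect ((u @^-1` [set y]) x).
        by rewrite mem_set// normr1 xA mulVf// normr_eq0.
      by rewrite memNset// normr0 mulr_ge0// invr_ge0.
    have := integrable_lty measurableT iy.
    by rewrite integral_indic// setIT.
  rewrite (_ : (fun x => _) = (fun x => y%:C * cind R (u @^-1` [set y]) x + 0)).
    by apply: C0F_ZD; [exact: C0F_cind|exact: C0F_0].
  by apply/funext => x; rewrite addr0 /cind -rmorphM.
rewrite (_ : (fun x => _) = (fun x =>
    (\sum_(y <- finmap.enum_fset (fset_set (range u)))
       y * \1_(u @^-1` [set y]) x)%:C)); last first.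
  by apply/funext => x; rewrite [in LHS]fimfunE fsbig_finite//.
elim: (finmap.enum_fset _) => [|y s IH].
  rewrite (_ : (fun x => _) = fun=> 0); first exact: C0F_0.
  by apply/funext => x; rewrite big_nil.
rewrite (_ : (fun x => _) = (fun x => 1 * (y * \1_(u @^-1` [set y]) x)%:C +
    (\sum_(y <- s) y * \1_(u @^-1` [set y]) x)%:C)); first exact: C0F_ZD.
by apply/funext => x; rewrite big_cons rmorphD/= mul1r.
Qed.

Let sfun_approx (u : borel H -> R) (e : R) :
  sigma.-integrable setT (EFin \o u) ->
  0 < e -> exists v : {sfun borel H >-> R},
    sigma.-integrable setT (EFin \o v) /\
    (\int[sigma]_x `|u x - v x| < e)%R.
Proof.
move=> iu e0; have [v [iv _]] := approximation_sfun_integrable measurableT iu.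
move=> /fine_fcvg/cvgrPdist_lt/(_ _ e0)[n _ /(_ n (leqnn n))] /= ne.
exists (v n); split => //; move: ne; rewrite sub0r normrN; apply: le_lt_trans.
exact: ler_norm.
Qed.

Lemma fourier_C0 f : cintegrable sigma f ->
  (fourier sigma f : dual H R -> R[i]) \in @C0_pred (dual H R) R.
Proof.
move=> fI; suff [] : C0F f by [].
apply: C0F_approx => // e e0.
have e20 : 0 < e / 2 by rewrite divr_gt0.
(* The real and imaginary parts are approximated separately, each up to e / 2. *)
have [v [iv vf]] := sfun_approx fI.1 e20.
have [w [iw wf]] := sfun_approx fI.2 e20.
have Cvw := C0F_ZD 'i (C0F_sfun iw) (C0F_sfun iv).
exists (fun x => 'i * (w x)%:C + (v x)%:C) => //.
have iev := integrable_abse (integrableB measurableT fI.1 iv).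
have iew := integrable_abse (integrableB measurableT fI.2 iw).
apply: (@le_trans _ _ ((\int[sigma]_x `|Re (f x) - v x|) +
  (\int[sigma]_x `|Im (f x) - w x|))%R); last first.
  by move: vf wf => /=; lra.
rewrite -RintegralD//.
apply: le_Rintegral => //.
- by apply: cintegrable_rnorm; apply: cintegrableB => //; exact: Cvw.1.
- have := integrableD measurableT iev iew; exact: eq_integrable.
- move=> x _; apply: le_trans (rnorm_le_ReIm _) _.
  by case: (f x) => a b /=; rewrite !(mul0r, mul1r, mulr0, subr0, addr0, add0r,
    oppr0).
Qed.

End fourier_all.

(** * Lushness *)

Section convex_facts.
Context (R : realType) (X : normedModType R[i]).
Implicit Types (C : set X) (r s t : R) (x y : X).

(** The weights in [convex_set] are elements of [R[i]] between 0 and 1; such elements are real. *)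
Lemma convex_setP C : @convex_set R[i] X C <->
  forall x y r, 0 <= r -> r <= 1 -> C x -> C y ->
    C (r%:C *: x + (1 - r)%:C *: y).
Proof.
have onemC (r : R) : (1 - r)%:C = 1 - r%:C :> R[i] by rewrite rmorphB rmorph1.
split=> [cC x y r r0 r1 Cx Cy|cC x y k].
  have r0' : 0 <= r%:C :> R[i] by rewrite lecR.
  have r1' : r%:C <= 1 :> R[i] by rewrite lecR.
  have := cC x y (Itv01 r0' r1'); rewrite !inE => /(_ Cx Cy).
  by rewrite onemC.
rewrite !inE => Cx Cy.
have kE : k%:num = (Re k%:num)%:C by rewrite RRe_real// ger0_real.
have k0 : 0 <= Re k%:num by rewrite -lecR -kE ge0.
have k1 : Re k%:num <= 1 by rewrite -lecR -kE le1.
have := cC x y _ k0 k1 Cx Cy.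
by rewrite onemC -kE.
Qed.

Section cone.
Variables (C : set X) (cC : @convex_set R[i] X C) (C_0 : C 0).

(** Dividing by s + t turns s c + t d into a convex combination of c and d. The factors add up just
    as the norms of functions with disjoint supports do. *)
Lemma cone_add s t x y : 0 <= s -> 0 <= t ->
  (exists2 c, C c & x = s%:C *: c) -> (exists2 c, C c & y = t%:C *: c) ->
  exists2 c, C c & x + y = (s + t)%:C *: c.
Proof.
move=> s0 t0 [c Cc ->] [d Cd ->].
have [st0|st0] := eqVneq (s + t) 0.
  have -> : s = 0 by lra.
  have -> : t = 0 by lra.
  by exists 0; rewrite // !scale0r addr0 scaler0.
have st : 0 < s + t by rewrite lt_neqAle eq_sym st0 addr_ge0.
exists ((s / (s + t))%:C *: c + (1 - s / (s + t))%:C *: d).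
  apply: (convex_setP C).1 => //; first by rewrite divr_ge0// ltW.
  by rewrite ler_pdivrMr// mul1r lerDl.
rewrite scalerDr !scalerA -!rmorphM/=; congr (_%:C *: _ + _%:C *: _).
  by rewrite mulrC divfK.
by rewrite mulrBr mulr1 mulrC divfK// addrC addKr.
Qed.

Lemma cone_le1 t x : 0 <= t -> t <= 1 -> (exists2 c, C c & x = t%:C *: c) ->
  C x.
Proof.
move=> t0 t1 [c Cc ->]; have := (convex_setP C).1 cC c 0 t t0 t1 Cc C_0.
by rewrite scaler0 addr0.
Qed.

End cone.

End convex_facts.

(** * Finite nets of directions *)

Section circle_net.
Context {R : realType}.

Lemma interval_net (d : R) : 0 < d -> exists s : seq R,
  forall a, - 1 <= a <= 1 -> exists2 u, u \in s & `|a - u| <= d.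
Proof.
(* A grid of step d starting at - 1; its last index, the floor of 2 / d, comes within d of 1. *)
move=> d0; exists [seq k%:R * d - 1 | k <- iota 0 (Num.truncn (2 / d)).+1] =>
  a /andP[a0 a1].
pose k := Num.truncn ((a + 1) / d).
have ad0 : 0 <= (a + 1) / d by rewrite divr_ge0 ?(ltW d0)//; lra.
have /andP[k1 k2] := truncn_itv ad0.
exists (k%:R * d - 1).
  apply/mapP; exists k => //; rewrite mem_iota/= add0n ltnS.
  apply: le_truncn; rewrite ler_wpM2r ?invr_ge0 ?(ltW d0)//; lra.
rewrite ler_pdivlMr// -/k in k1; rewrite ltr_pdivrMr// -/k -natr1 mulrDl mul1r
  in k2.
by rewrite ler_norml; apply/andP; split; lra.
Qed.

(** The net is taken in the square [-1, 1]^2, with error d / 2 in each coordinate, so its elements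
    need not be unimodular. Only closeness to z / |z| matters. *)
Lemma direction_net (d : R) : 0 < d -> exists s : seq R[i],
  forall z : R[i], z != 0 -> exists2 u, u \in s &
    rnorm (z - (rnorm z)%:C * u) <= d * rnorm z.
Proof.
move=> d0; have d20 : 0 < d / 2 by rewrite divr_gt0.
have [s hs] := interval_net d20.
exists [seq a +i* b | a <- s, b <- s] => z z0.
have r0 : 0 < rnorm z.
  by rewrite lt_neqAle rnorm_ge0 andbT eq_sym;
    apply: contra_neq z0 => /rnorm0_eq0.
have bnd (a : R) : `|a| <= rnorm z -> - 1 <= a / rnorm z <= 1.
  by rewrite -ler_norml normrM normfV (gtr0_norm r0) ler_pdivrMr// mul1r.
have [a sa za] := hs _ (bnd _ (normr_Re_le z)).
have [b sb zb] := hs _ (bnd _ (normr_Im_le z)).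
exists (a +i* b); first by apply: allpairs_f.
have scal (p q : R) : `|p / rnorm z - q| <= d / 2 ->
  `|p - rnorm z * q| <= d / 2 * rnorm z.
  have -> : p - rnorm z * q = (p / rnorm z - q) * rnorm z.
    by rewrite mulrBl divfK ?gt_eqF// mulrC.
  by move=> h; rewrite normrM (gtr0_norm r0) ler_wpM2r// ltW.
apply: le_trans (rnorm_le_ReIm _) _.
have := scal _ _ za; have := scal _ _ zb.
case: (z) => p q /=; rewrite !mul0r subr0 addr0; lra.
Qed.

End circle_net.

Section L1_facts.
Context d (T : measurableType d) (R : realType).
Context (mu : {measure set T -> \bar R}).

Definition mkL1fun (f : T -> R[i]) (fI : cintegrable mu f) : L1fun mu :=
  exist _ f (asboolT fI).

Lemma L1fun_cintegrable (f : L1fun mu) : cintegrable mu f.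
Proof. exact/asboolP/(valP f). Qed.

Lemma rnorm_L1_pi (f : L1fun mu) : rnorm (L1_pi f) = (\int[mu]_x rnorm (f x))%R.
Proof. by apply: complexI; rewrite rnormE -L1_norm_pi. Qed.

Lemma Rintegral_rnorm_L1_pi0 (f : L1fun mu) : L1_pi f = 0 ->
  (\int[mu]_x rnorm (f x))%R = 0.
Proof. by rewrite -rnorm_L1_pi => ->; rewrite rnorm0. Qed.

End L1_facts.

(** * The transform as an operator on classes of functions *)

Section fourier_op.
Context (H : topologicalZmodType) (R : realType).
Context (sigma : {measure set (borel H) -> \bar R}).
Context (haar : haar_measure sigma) (hausH : hausdorff_space H).
Notation L1H := (L1 sigma).
Notation C0G := (C0 (dual H R) R).

(** A chosen representative is transformed; [fourier_op_funE] shows that the choice is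
    immaterial. *)
Definition fourier_op_fun (x : L1H) : C0G :=
  exist _ (fourier sigma (L1_repr x))
    (fourier_C0 haar hausH (L1fun_cintegrable (L1_repr x))).

(** Two representatives differ by a function of L1 norm 0, and this norm bounds the difference of
    the transforms. *)
Lemma fourier_op_funE (f : L1fun sigma) (g : dual H R) :
  (fourier_op_fun (L1_pi f) : C0G) g = fourier sigma f g.
Proof.
rewrite /fourier_op_fun /= -[C0_fun _ g]/(fourier sigma _ g).
set f' := L1_repr _.
apply/eqP; rewrite -subr_eq0; apply/eqP/rnorm0_eq0/eqP.
rewrite eq_le rnorm_ge0 andbT.
apply: le_trans (rnorm_fourierB g (L1fun_cintegrable f')
  (L1fun_cintegrable f)) _.
have := @Rintegral_rnorm_L1_pi0 _ _ _ sigma (f' - f).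
rewrite raddfB/= /f' L1_piK subrr => /(_ erefl) h.
by rewrite -[leRHS]h.
Qed.

Lemma fourier_op_linear a (x y : L1H) :
  fourier_op_fun (a *: x + y) = a *: fourier_op_fun x + fourier_op_fun y.
Proof.
rewrite -[x]L1_piK -[y]L1_piK -linearP/=.
apply/val_inj/funext => g.
rewrite -[LHS]/(fourier_op_fun (L1_pi _) g).
rewrite -[RHS]/(a * fourier_op_fun (L1_pi _) g + fourier_op_fun (L1_pi _) g).
rewrite !fourier_op_funE.
rewrite -[RHS]/((a *: (fourier sigma (L1_repr x) : dual H R -> R[i]) +
  fourier sigma (L1_repr y)) g).
rewrite -fourierZD//; exact: L1fun_cintegrable.
Qed.

HB.instance Definition _ := GRing.isLinear.Build R[i] L1H C0G _ fourier_op_fun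
  fourier_op_linear.

Definition fourier_op : {linear L1H -> C0G} := fourier_op_fun.

End fourier_op.

(** * Convex sets containing the functions with large transform at g *)

Section fourier_ball.
Context (H : topologicalZmodType) (R : realType).
Context (sigma : {measure set (borel H) -> \bar R}).
Context (haar : haar_measure sigma) (hausH : hausdorff_space H).
Notation L1H := (L1 sigma).
Notation C0G := (C0 (dual H R) R).
Notation F := (fourier_op haar hausH).

Lemma haar_compact_gt0 : exists2 K : set H, compact K & (0 < sigma K)%E.
Proof.
have [s0 _ _ _ inner] := haar.
have : (0 < sigma setT)%E by rewrite lt0e s0/=.
rewrite (inner setT openT) => /ereal_sup_gt[_ [K [cK _] <-] K0].
by exists K.
Qed.

(** Take g times the normalized indicator of a compact set of positive measure: g x cancels the
    factor g (- x) of the transform at g, leaving an integral equal to 1. *)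
Lemma fourier_op_unit (g : dual H R) :
  exists2 u : L1H, rnorm u = 1 & (F u : C0G) g = 1.
Proof.
have [K cK K0] := haar_compact_gt0.
have mK := haar_compact_measurable hausH cK;
  have Koo := haar_compact_lty haar cK.
have s0 : 0 < fine (sigma K) by rewrite fine_gt0// K0.
have [c c0 s0'] : exists2 c : R, 0 < c & c * fine (sigma K) = 1.
  by exists (fine (sigma K))^-1; rewrite ?invr_gt0// mulVf// gt_eqF.
have KI := cintegrable_cind mK Koo.
pose f := fun x : borel H => c%:C * borel_cind K x.
have fI : cintegrable sigma f by exact: cintegrableZ.
have ugI : cintegrable sigma (fun x : borel H => f x * g (x : H)).
  apply: (@cintegrable_mul _ _ _ _ g 1) => //; first exact: dual_continuous.
  by move=> x; rewrite dual_rnorm.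
exists (L1_pi (mkL1fun ugI)).
  rewrite rnorm_L1_pi -s0' -Rintegral_indic// -RintegralZl//;
    last exact: integrable_indic_lty.
  apply: eq_Rintegral => x _.
  rewrite -[L1fun_fun _ x]/(f x * g x) rnormM dual_rnorm mulr1 /f rnormM
    rnorm_cind rnormc_real.
  by rewrite gtr0_norm.
rewrite fourier_op_funE /fourier.
rewrite (_ : (fun x => _) = f); last first.
  by apply/funext => x; rewrite -[L1fun_fun _ x]/(f x * g x) -mulrA dualN mulr1.
rewrite cintegralZ//.
have -> : cintegral sigma (borel_cind K) = (fine (sigma K))%:C.
  apply/eqP; rewrite eq_complex/=; apply/andP; split; apply/eqP.
    exact: Rintegral_indic.
  by rewrite Rintegral_cst// mul0r.
by rewrite -rmorphM s0'.
Qed.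

Section core.
Variables (g : dual H R) (dl : R) (C : set L1H).
Hypotheses (dl0 : 0 < dl) (cC : @convex_set R[i] L1H C).
Hypothesis DC : forall x : L1H, rnorm x <= 1 ->
  1 - dl < rnorm ((F x : C0G) g) -> C x.

(** 0 is the midpoint of u and - u, where u is a unit vector with F u g = 1. *)
Let C_0 : C 0.
Proof.
have [u u1 Fu] := fourier_op_unit g.
have Cu : C u by apply: DC; [rewrite u1|rewrite Fu rnorm1 ltrBlDr ltrDl].
have CNu : C (- u).
  apply: DC; first by rewrite rnormN u1.
  rewrite raddfN/= -[C0_fun _ g]/(- ((F u : C0G) g)).
  by rewrite Fu rnormN rnorm1 ltrBlDr ltrDl.
have h0 : 0 <= 2^-1 :> R by rewrite invr_ge0.
have h1 : 2^-1 <= 1 :> R by lra.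
have := (convex_setP C).1 cC u (- u) _ h0 h1 Cu CNu.
have -> : 1 - 2^-1 = 2^-1 :> R by lra.
by rewrite scalerN subrr.
Qed.

(** Membership in t C. The aim is to put every f in C scaled by the norm of f. *)
Let cone (t : R) (x : L1H) := exists2 c, C c & x = t%:C *: c.

Let twist (f : L1fun sigma) := fun x : borel H => f x * g (- (x : H)).

Let rnorm_twist f x : rnorm (twist f x) = rnorm (f x).
Proof. by rewrite /twist rnormM dual_rnorm mulr1. Qed.

(** One error d in the modulus of the direction and one in the integral leave |F f g| at least 1 - 2
    d times the norm of f, more than the required factor 1 - dl. *)
Let d := dl / 4.

Let d0 : 0 < d. Proof. by rewrite divr_gt0. Qed.

(* The values of the twisted function point in almost the same direction, hence
   there is almost no cancellation in its integral. *)
Let cone_sector (u : R[i]) (f : L1fun sigma) :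
  (forall x, rnorm (twist f x - (rnorm (twist f x))%:C * u) <=
    d * rnorm (twist f x)) ->
  cone (\int[sigma]_x rnorm (f x))%R (L1_pi f).
Proof.
move=> fu; have fI := L1fun_cintegrable f; have tI := cintegrable_twist g fI.
set r := (\int[sigma]_x rnorm (f x))%R.
have r0 : 0 <= r by apply: Rintegral_ge0 => x _; exact: rnorm_ge0.
have [re|rn] := eqVneq r 0.
  have -> : L1_pi f = 0 by apply: rnorm0_eq0; rewrite rnorm_L1_pi.
  by rewrite re; exists 0; rewrite ?scaler0.
have rp : 0 < r by rewrite lt_neqAle eq_sym rn.
(* At a point where f does not vanish, u is within d of a unimodular number. *)
have u1 : 1 - d <= rnorm u.
  have [x fx] : exists x, f x != 0.
    apply: contra_notP (elimN eqP rn) => /forallNP fx0.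
    rewrite /r; under eq_Rintegral.
      move=> x _; have /negP/negPn/eqP -> := fx0 x; rewrite rnorm0; over.
    by rewrite Rintegral_cst// mul0r.
  have zp : 0 < rnorm (f x).
    by rewrite lt_neqAle rnorm_ge0 andbT eq_sym;
      apply: contra_neq fx => /rnorm0_eq0.
  have := ler_rnorm_sub (twist f x) ((rnorm (twist f x))%:C * u).
  have := fu x; rewrite rnormM rnormc_real !rnorm_twist (ger0_norm (ltW zp)).
  move=> h1 h2; have : (1 - d) * rnorm (f x) <= rnorm u * rnorm (f x) by lra.
  by rewrite ler_pM2r.
exists (r^-1%:C *: L1_pi f); last first.
  by rewrite scalerA -rmorphM/= divff// scale1r.
apply: DC.
  by rewrite rnormZ rnorm_L1_pi rnormc_real gtr0_norm ?invr_gt0// mulVf.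
rewrite linearZ/= -[C0_fun _ g]/(r^-1%:C * (F (L1_pi f) : C0G) g).
rewrite rnormM rnormc_real gtr0_norm ?invr_gt0// mulrC ltr_pdivlMr//.
rewrite fourier_op_funE.
have uI := cintegrable_rnormZ u tI.
have eI := cintegrableB tI uI.
have rE : cintegral sigma (fun x => (rnorm (twist f x))%:C * u) = r%:C * u.
  under eq_fun do rewrite mulrC.
  rewrite cintegralZ; last first.
    have := cintegrable_rnormZ 1 tI; congr cintegrable.
    by apply/funext => x; rewrite mulr1.
  rewrite mulrC; congr (_ * _); apply/eqP; rewrite eq_complex/=.
  apply/andP; split; apply/eqP.
    by apply: eq_Rintegral => x _; rewrite rnorm_twist.
  by rewrite Rintegral_cst// mul0r.
(* Replacing the twisted function by its modulus times u moves the integral by at most d * r. *)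
have dist : rnorm (r%:C * u - fourier sigma f g) <= d * r.
  rewrite rnormB -rE /fourier -(cintegralB tI uI).
  apply: le_trans (le_rnorm_cintegral eI) _.
  rewrite /r -RintegralZl//; last exact: cintegrable_rnorm.
  apply: le_Rintegral => //.
  - exact: cintegrable_rnorm.
  - have := integrableZl measurableT d (cintegrable_rnorm fI);
      exact: eq_integrable.
  - by move=> x _; rewrite -rnorm_twist; exact: fu.
have := ler_rnorm_sub (r%:C * u) (fourier sigma f g).
rewrite rnormM rnormc_real (ger0_norm r0) => h.
have : r * (1 - d) <= r * rnorm u by rewrite ler_wpM2l.
have := mulr_gt0 rp d0; have -> : dl = 4 * d by rewrite /d; lra.
lra.
Qed.

(* Peeling off one sector at a time splits f into pieces with disjoint supports,
   so that their norms add up to the norm of f. *)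
Let cone_sectors (s : seq R[i]) (f : L1fun sigma) :
  (forall x, twist f x != 0 -> exists2 u, u \in s &
     rnorm (twist f x - (rnorm (twist f x))%:C * u) <= d * rnorm (twist f x)) ->
  cone (\int[sigma]_x rnorm (f x))%R (L1_pi f).
Proof.
elim: s f => [|u s IH] f fs.
  (* With no direction left the twisted function vanishes everywhere, so direction 0 fits. *)
  apply: (@cone_sector 0) => x; case: (eqVneq (twist f x) 0) => [->|/fs[]//].
  by rewrite !rnorm0 mulr0 subr0 mulr0 rnorm0.
have fI := L1fun_cintegrable f; have tI := cintegrable_twist g fI.
(* S is where the first direction u fits; off S one of the remaining directions must. *)
pose S := [set x | rnorm (twist f x - (rnorm (twist f x))%:C * u) <=
  d * rnorm (twist f x)].
have mS : measurable S.
  exact: (measurable_rnorm_le d (cintegrableB tI (cintegrable_rnormZ u tI)) tI).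
have mCS : measurable (~` S) by exact: measurableC.
pose f1 := mkL1fun (cintegrable_indic fI mS).
pose f2 := mkL1fun (cintegrable_indic fI mCS).
have f1E x : f1 x = f x * (\1_S x)%:C by [].
have f2E x : f2 x = f x * (\1_(~` S) x)%:C by [].
have fE x : f x = f1 x + f2 x.
  rewrite f1E f2E -mulrDr -rmorphD/= !indicE.
  have [xS|xS] := pselect (S x).
    by rewrite (mem_set xS) memNset ?addr0 ?mulr1//; apply.
  by rewrite (memNset xS) mem_set// add0r mulr1.
have -> : L1_pi f = L1_pi f1 + L1_pi f2.
  rewrite -raddfD; apply/L1_piP; apply: aeW => x; exact: fE.
have -> : (\int[sigma]_x rnorm (f x) =
    \int[sigma]_x rnorm (f1 x) + \int[sigma]_x rnorm (f2 x))%R.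
  rewrite -RintegralD//; [|exact/cintegrable_rnorm/L1fun_cintegrable..].
  apply: eq_Rintegral => x _; rewrite f1E f2E !rnormM !rnormc_real -mulrDr
    !indicE.
  have [xS|xS] := pselect (S x).
    by rewrite (mem_set xS) memNset ?normr0 ?normr1 ?addr0 ?mulr1//; apply.
  by rewrite (memNset xS) mem_set// normr0 normr1 add0r mulr1.
apply: (cone_add cC C_0).
- by apply: Rintegral_ge0 => x _; exact: rnorm_ge0.
- by apply: Rintegral_ge0 => x _; exact: rnorm_ge0.
- apply: (@cone_sector u) => x; rewrite /twist f1E indicE.
  have [xS|xS] := pselect (S x); first by rewrite (mem_set xS) mulr1; exact: xS.
  by rewrite (memNset xS) mulr0 mul0r !rnorm0 mul0r subr0 mulr0 rnorm0.
- apply: IH => x; rewrite /twist f2E indicE.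
  have [xS|xS] := pselect (S x).
    by rewrite memNset ?mulr0 ?mul0r ?eqxx//; apply.
  rewrite mem_set// mulr1 => /fs[v]; rewrite inE => /orP[/eqP ->|vs];
    last by exists v.
  by move=> /xS.
Qed.

(** [C] is arbitrary so as to serve twice: for a convex set containing the unimodular multiples of a
    slice (lushness) and for a sublevel set of |T x g| (spear property). The net of directions puts
    x in |x| C, which lies in C since |x| <= 1 and 0 is in C. *)
Lemma unit_ball_sub_convex (x : L1H) : rnorm x <= 1 -> C x.
Proof.
move=> x1; have [s hs] := direction_net d0.
have x0 : 0 <= rnorm x by exact: rnorm_ge0.
apply: (cone_le1 cC C_0 x0 x1).
rewrite -[x]L1_piK rnorm_L1_pi; apply: (@cone_sectors s) => y; exact: hs.
Qed.

End core.

End fourier_ball.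

(** * Lushness and the spear property of the transform *)

Section fourier_lush.
Context (H : topologicalZmodType) (R : realType).
Context (sigma : {measure set (borel H) -> \bar R}).
Context (haar : haar_measure sigma) (hausH : hausdorff_space H).
Notation L1H := (L1 sigma).
Notation C0G := (C0 (dual H R) R).
Notation F := (fourier_op haar hausH).

Lemma rnorm_C0E (y : C0G) : rnorm y = sup (range (fun g => rnorm (y g))).
Proof. by apply: complexI; rewrite rnormE. Qed.

Lemma le_rnorm_C0 (y : C0G) g : rnorm (y g) <= rnorm y.
Proof. by rewrite rnorm_C0E; exact: C0_norm_ge. Qed.

Lemma rnorm_C0_le (y : C0G) (M : R) : 0 <= M -> (forall g, rnorm (y g) <= M) ->
  rnorm y <= M.
Proof. by move=> M0 yM; rewrite rnorm_C0E; exact: C0_sup_le. Qed.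

Lemma le_rnorm_fourier_op (x : L1H) : rnorm (F x) <= rnorm x.
Proof.
apply: rnorm_C0_le => [|g]; first exact: rnorm_ge0.
rewrite -[x]L1_piK fourier_op_funE rnorm_L1_pi.
exact/le_rnorm_fourier/L1fun_cintegrable.
Qed.

Lemma fourier_op_continuous : continuous F.
Proof.
move=> x; apply/(@cvgrPdist_lt _ _ _ _ (nbhs_filter x)) => e e0.
have : \forall y \near x, `|x - y| < e.
  exact: ((@cvgrPdist_lt _ _ _ _ (nbhs_filter x) id x).1 cvg_id _ e0).
apply: (@filterS _ _ (nbhs_filter x)) => y; apply: le_lt_trans.
by rewrite -linearB -!rnormE lecR; exact: le_rnorm_fourier_op.
Qed.

(** The trivial character makes the dual nonempty, so that suprema over it can be approached at some
    character. *)
Lemma dual_unit_exists : exists g : dual H R, forall x, g x = 1.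
Proof.
have ch : character (cst 1 : H -> R[i]).
  split=> [x|x y|x]; first exact: cvg_cst.
    by rewrite mulr1.
  by apply/unit_circleP; rewrite rnorm1.
by exists (exist _ (cst 1 : H -> R[i]) (asboolT ch)).
Qed.

Lemma opnorm_fourier_op : opnorm F = 1%E.
Proof.
apply/eqP; rewrite eq_le; apply/andP; split.
  apply: ge_ereal_sup => _ [x /unit_ballP x1 <-].
  by rewrite lee_fin (le_trans (le_rnorm_fourier_op x)).
have [g _] := dual_unit_exists.
have [u u1 Fu] := fourier_op_unit haar hausH g.
have : rnorm u <= 1 by rewrite u1.
move=> /(opnorm_ge F); apply: le_trans.
by rewrite lee_fin -(rnorm1 (R := R)) -Fu; exact: le_rnorm_C0.
Qed.

Lemma linear_C0_eval (T : {linear L1H -> C0G}) (a b : R[i]) (x y : L1H) g :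
  (T (a *: x + b *: y) : C0G) g = a * (T x : C0G) g + b * (T y : C0G) g.
Proof. by rewrite linearP linearZ. Qed.

Lemma linear_C0_evalZ (T : {linear L1H -> C0G}) (a : R[i]) (x : L1H) g :
  (T (a *: x) : C0G) g = a * (T x : C0G) g.
Proof. by rewrite linearZ. Qed.

Lemma convex_C0_functional (T : {linear L1H -> C0G}) (g : dual H R) (M : R) :
  @convex_set R[i] L1H [set x | rnorm ((T x : C0G) g) <= M].
Proof.
apply/convex_setP => x y r r0 r1 /= xM yM.
rewrite linear_C0_eval.
apply: le_trans (rnormD _ _) _; rewrite !rnormM !rnormc_real !ger0_norm//;
  last by rewrite subr_ge0.
have := ler_wpM2l r0 xM; have r1' : 0 <= 1 - r by rewrite subr_ge0.
have := ler_wpM2l r1' yM; lra.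
Qed.

Lemma fourier_op_lush : lush_operator F.
Proof.
split; [exact: fourier_op_continuous|exact: opnorm_fourier_op|].
move=> x0 e y /unit_ballP x01 e0 /unit_sphereP y1.
have e20 : 0 < e / 2 by rewrite divr_gt0.
have [g yg] : exists g, 1 - e / 2 < rnorm ((y : C0G) g).
  have hs : has_sup (range (fun g => rnorm ((y : C0G) g))).
    split; last exact: C0_bounded.
    by have [g _] := dual_unit_exists; exists (rnorm ((y : C0G) g)), g.
  by have [_ [g _ <-]] := sup_adherent e20 hs; rewrite -rnorm_C0E y1; exists g.
have [w /unit_circleP w1 wy] := phaseP ((y : C0G) g).
have wc1 : w * w^* = 1 by exact/unit_circle_mulc_conj/unit_circleP.
(* A slice of the ball: after rotation by w, closeness to the phase of y g becomes a lower bound on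
   a real part, a convex condition. *)
pose A := [set x : L1H | rnorm x <= 1 /\ 1 - e / 2 < Re (w * (F x : C0G) g)].
have cA : @convex_set R[i] L1H A.
  apply/convex_setP => p q r r0 r1 [p1 pA] [q1 qA].
  have r1' : 0 <= 1 - r by rewrite subr_ge0.
  split.
    apply: le_trans (rnormD (r%:C *: p) ((1 - r)%:C *: q)) _.
    rewrite !rnormZ !rnormc_real !ger0_norm//.
    have := ler_wpM2l r0 p1; have := ler_wpM2l r1' q1; lra.
  rewrite linear_C0_eval mulrDr !(mulrCA w) complex_ReD !(complex_ReM _%:C)
    !mul0r !subr0/=.
  set a := Re _ in pA *; set b := Re _ in qA *.
  (* Strictness comes from the term of p when r > 0; for r = 0 the combination is q. *)
  have [rp|rn] := ltP 0 r.
    have ra : r * (1 - e / 2) < r * a by rewrite ltr_pM2l.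
    by have := ler_wpM2l r1' (ltW qA); lra.
  have -> : r = 0 by lra.
  by rewrite mul0r add0r subr0 mul1r.
exists A; split.
- by move=> x [x1 _]; exact/unit_ballP.
(* Being convex, A contains its hull. On A the real parts of w F x g and w y g both exceed 1 - e /
   2. *)
- move=> x xA0; have [x1 xA] : A x by apply: xA0; split => //.
  split; first exact/unit_ballP.
  apply: lt_le_trans (le_rnorm_C0 (F x + y) g).
  rewrite -[C0_fun _ g]/((F x : C0G) g + (y : C0G) g).
  rewrite -[ltRHS]mul1r -w1 -rnormM; apply: lt_le_trans (Re_le_rnorm _).
  rewrite mulrDr complex_ReD wy /=; lra.
(* The distance is 0, as x0 itself lies in the absolutely convex hull. *)
- apply: (@le_lt_trans _ _ 0%E); last by rewrite lte_fin.
  apply: ereal_inf_lbound; exists x0; last by rewrite subrr rnorm0.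
  move=> C [cC AC].
  apply: (@unit_ball_sub_convex _ _ _ haar hausH g (e / 2) C) => // x x1 xd.
  have [v /unit_circleP v1 vF] := phaseP ((F x : C0G) g).
  have vc1 : v * v^* = 1 by exact/unit_circle_mulc_conj/unit_circleP.
  (* Multiplied by v and the conjugate of w, x enters A, since w times the new transform at g is |F
     x g|. The present factor undoes this rotation. *)
  apply: AC; exists (w * v^*).
    by apply/unit_circleP; rewrite rnormM rnormc_conj w1 v1 mulr1.
  exists ((w^* * v) *: x); last first.
    rewrite scalerA (_ : _ * _ = (w * w^*) * (v * v^*)); last by ring.
    by rewrite wc1 vc1 mulr1 scale1r.
  split; first by rewrite rnormZ rnormM rnormc_conj w1 v1 !mul1r.
  rewrite linear_C0_evalZ.
  by rewrite !mulrA wc1 mul1r vF.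
Qed.

Lemma fourier_op_spear : spear_operator F.
Proof.
move=> T _; apply/eqP; rewrite eq_le; apply/andP; split.
  apply: ge_ereal_sup => _ [w /unit_circleP w1 <-].
  apply: ge_ereal_sup => _ [x /unit_ballP x1 <-].
  apply: (@le_trans _ _ ((rnorm (F x))%:E + (rnorm (T x))%:E)%E).
    by rewrite -EFinD lee_fin (le_trans (rnormD _ _))// rnormZ w1 mul1r.
  apply: leeD; last exact: opnorm_ge.
  by rewrite lee_fin (le_trans (le_rnorm_fourier_op x)).
set S := ereal_sup _.
have key (g : dual H R) (x : L1H) : rnorm x <= 1 ->
    ((rnorm ((F x : C0G) g) + rnorm ((T x : C0G) g))%:E <= S)%E.
  move=> x1.
  have [v /unit_circleP v1 vF] := phaseP ((F x : C0G) g).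
  have [v' /unit_circleP v1' vT] := phaseP ((T x : C0G) g).
  have vc1 : v * v^* = 1 by exact/unit_circle_mulc_conj/unit_circleP.
  (* This w aligns w T x g with F x g, so that the moduli add. *)
  pose w := v^* * v'.
  have w1 : unit_circle w by apply/unit_circleP;
    rewrite rnormM rnormc_conj v1 v1' mulr1.
  apply: (@le_trans _ _ (opnorm (fun x => F x + w *: T x))); last first.
    by apply: ereal_sup_ubound; exists w.
  apply: le_trans (opnorm_ge (fun x => F x + w *: T x) x1).
  rewrite lee_fin; apply: le_trans (le_rnorm_C0 _ g).
  rewrite -[C0_fun (_ + _) g]/((F x : C0G) g + w * (T x : C0G) g).
  rewrite -[leRHS]mul1r -v1 -rnormM.
  have -> : v * ((F x : C0G) g + w * (T x : C0G) g) =
      (rnorm ((F x : C0G) g) + rnorm ((T x : C0G) g))%:C.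
    rewrite rmorphD/= -vF -vT /w mulrDr; congr (_ + _).
    by rewrite !mulrA vc1 mul1r.
  by rewrite rnormc_real ler_norm.
have [g1 _] := dual_unit_exists.
have [u u1 Fu] := fourier_op_unit haar hausH g1.
(* S = +oo makes the bound trivial, and S = -oo contradicts [key] at u. *)
move: key; case: S => [s key|_|key]; last 2 first.
- by rewrite leey.
- by have := key g1 u; rewrite u1 leeNy_eq => /(_ (lexx _)).
(* Evaluating [key] at u gives s >= 1; [rnorm_C0_le] asks for a nonnegative bound. *)
have s1 : 0 <= s - 1.
  have := key g1 u; rewrite u1 Fu rnorm1 lee_fin => /(_ (lexx _)).
  have := rnorm_ge0 ((T u : C0G) g1) => h1 h2; lra.
rewrite addeC -leeBrDr// -EFinB.
apply: ge_ereal_sup => _ [x /unit_ballP x1 <-]; rewrite lee_fin.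
apply: rnorm_C0_le => // g; apply/ler_addgt0Pr => dl dl0.
apply: (@unit_ball_sub_convex _ _ _ haar hausH g dl
  [set x | rnorm ((T x : C0G) g) <= s - 1 + dl]) x1 => //.
  exact: convex_C0_functional.
move=> z z1 zd /=; have := key g z z1; rewrite lee_fin => h; lra.
Qed.

End fourier_lush.

Theorem theorem4p1 (R : realType) (H : topologicalZmodType)
    (sigma : {measure set (borel H) -> \bar R}) :
  hausdorff_space H -> locally_compact [set: H] -> haar_measure sigma ->
  exists F : {linear L1 sigma -> C0 (dual H R) R},
    [/\ forall (f : L1fun sigma) (g : dual H R),
          (F (L1_pi f) : C0 (dual H R) R) g = fourier sigma f g,
        lush_operator F
      & spear_operator F].
Proof.
move=> hausH _ haar; exists (fourier_op haar hausH); split.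
- exact: fourier_op_funE.
- exact: fourier_op_lush.
- exact: fourier_op_spear.
Qed.
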